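(* Let $(X,d)$ be a geometrically doubling metric space equipped with an upper doubling measure $\mu$ with dominating function $\lambda$. For $f\in L^1_{\mathrm{loc}}(\mu)$, the following are equivalent: (a) $f\in\mathrm{RBMO}(\mu)$. (b) There exists a constant $C_b$ such that for any ball $B$ $$\frac{1}{\mu(6B)}\int_B|f(x)-m_Bf|\,d\mu(x)\le C_b$$ and $$|m_Qf-m_Rf|\le C_bK_{Q,R}\Big(\frac{\mu(6Q)}{\mu(Q)}+\frac{\mu(6R)}{\mu(R)}\Big)\quad\text{for any two balls }Q\subset R.$$ (c) There exists a constant $C_c$ such that for any doubling ball $B$ $$\frac{1}{\mu(B)}\int_B|f(x)-m_Bf|\,d\mu(x)\le C_c$$ and $$|m_Qf-m_Rf|\le C_cK_{Q,R}\quad\text{for any two doubling balls }Q\subset R.$$ Moreover, the best constants $C_b$ and $C_c$ are comparable to $\|f\|_{\mathrm{RBMO}(\mu)}$.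
   Context: $B(x,r)=\{y: d(y,x)<r\}$. A ball $B$ has center $x_B$ and radius $r_B$, and $aB=B(x_B,ar_B)$. Geometrically doubling: there is $N\in\mathbb{N}$ such that every ball $B(x,r)$ can be covered by at most $N$ balls of radius $r/2$; put $n=\log_2N$. Upper doubling: $\mu$ is a Borel measure and there is $\lambda:X\times(0,\infty)\to(0,\infty)$ such that $r\mapsto\lambda(x,r)$ is increasing for each $x$; $\lambda(x,2r)\le C_\lambda\lambda(x,r)$; $\mu(B(x,r))\le\lambda(x,r)$; and $\lambda(x,r)\approx\lambda(y,r)$ (uniform constants) whenever $d(x,y)\le r$. A ball $B$ is $(\alpha,\beta)$-doubling if $\mu(\alpha B)\le\beta\mu(B)$. ''Doubling ball'' means $(6,\beta_0)$-doubling ball, with $\beta_0>\max\{C_\lambda^{3\log_26},6^{3n}\}$ fixed. $m_Bf=\frac1{\mu(B)}\int_Bf\,d\mu$. For balls $B\subset Q$, $K_{B,Q}=1+\int_{r_B\le d(x,x_B)\le r_Q}\frac{1}{\lambda(x_B,d(x,x_B))}\,d\mu(x)$. $\mathrm{RBMO}(\mu)$: fix $\rho>1$. A function $f\in L^1_{\mathrm{loc}}(\mu)$ is in $\mathrm{RBMO}(\mu)$ if there are a constant $C$ and, for every ball $B$, a number $f_B$ such that $\frac1{\mu(\rho B)}\int_B|f-f_B|\,d\mu\le C$ for every ball $B$ and $|f_B-f_{B_1}|\le C K_{B,B_1}$ for all balls $B\subset B_1$. The infimum of such $C$ is $\|f\|_{\mathrm{RBMO}(\mu)}$ (different $\rho>1$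 give equivalent norms). *)

(* Defs.v *)
From HB Require Import structures.
From mathcomp Require Import all_boot all_order all_algebra.
From mathcomp Require Import all_classical all_reals all_analysis.

Set Implicit Arguments.
Unset Strict Implicit.
Unset Printing Implicit Defensive.

Import Order.TTheory GRing.Theory Num.Theory.
Import numFieldNormedType.Exports.

Local Open Scope classical_set_scope.
Local Open Scope ring_scope.

#[short(type="measurableMetricType")]
HB.structure Definition MeasurableMetric (d : measure_display)
  (R : numDomainType) := { X of Metric R X & Measurable d X }.

Section definitions.
Context {d : measure_display} {R : realType} (X : measurableMetricType d R).

Definition borel_measurable : Prop := @measurable d X = <<s @open X >>.

Definition geometrically_doubling (N : nat) : Prop :=
  forall (x : X) (r : R), 0 < r ->
    exists2 s : seq X, (size s <= N)%N &
      ball x r `<=` \bigcup_(y in [set` s]) ball y (r / 2).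

(* A ball is a center together with a radius: different pairs may have the
   same underlying set. *)
Record mball := MBall { center : X; radius : R; radius_gt0 : 0 < radius }.

Definition dilate (a : R) (B : mball) : set X := ball (center B) (a * radius B).

Definition ball_set (B : mball) : set X := ball (center B) (radius B).

End definitions.

Coercion ball_set : mball >-> set.

Section rbmo.
Context {d : measure_display} {R : realType} {X : measurableMetricType d R}.
Variables (mu : {measure set X -> \bar R}) (lam : X -> R -> R).
Implicit Types (B Q S : mball X) (f : X -> R) (C : R).

(* Only the values of lam x r for r > 0 matter. *)
Definition upper_doubling (Clam : R) : Prop :=
  [/\ forall x r, 0 < r -> 0 < lam x r,
      forall x r s, 0 < r -> r <= s -> lam x r <= lam x s,
      forall x r, 0 < r -> lam x (2 * r) <= Clam * lam x r,
      forall x r, 0 < r -> (mu (ball x r) <= (lam x r)%:E)%E &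
      exists C : R, forall x y r, 0 < r -> mdist x y <= r ->
        lam x r <= C * lam y r].

Definition log2 (x : R) : R := ln x / ln 2.

Definition doubling_threshold (N : nat) (Clam : R) : R :=
  Num.max (Clam `^ (3 * log2 6)) (6 `^ (3 * log2 N%:R)).

Definition doubling_ball (alpha beta : R) B : Prop :=
  (mu (dilate alpha B) <= beta%:E * mu B)%E.

Definition L1loc f : Prop := forall B, mu.-integrable B (EFin \o f).

(* When mu is upper doubling, balls have finite measure and the integral
   defining K is finite, so that passing to real numbers loses nothing. *)
Definition mass (A : set X) : R := fine (mu A).

Definition mean f B : R := (mass B)^-1 * \int[mu]_(x in B) f x.

Definition K B Q : R :=
  1 + \int[mu]_(x in [set x | radius B <= mdist x (center B) <= radius Q])
        (lam (center B) (mdist x (center B)))^-1.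

Definition RBMO_const (rho : R) f C : Prop :=
  exists fB : mball X -> R,
    (forall B,
       (mass (dilate rho B))^-1 * \int[mu]_(x in B) `|f x - fB B| <= C) /\
    (forall B Q, B `<=` Q -> `|fB B - fB Q| <= C * K B Q).

Definition RBMO (rho : R) f : Prop := exists C, RBMO_const rho f C.

Definition RBMO_norm (rho : R) f : R := inf [set C | RBMO_const rho f C].

(* The support of mu need not be the whole space: averages and quotients are
   only formed over balls of positive measure, the others having no average.
   The condition 0 <= C is automatic unless mu = 0. *)
Definition ball_const f C : Prop :=
  [/\ 0 <= C,
      forall B, (0 < mu B)%E ->
        (mass (dilate 6 B))^-1 * \int[mu]_(x in B) `|f x - mean f B| <= C &
      forall Q S, (0 < mu Q)%E -> (0 < mu S)%E -> Q `<=` S ->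
        `|mean f Q - mean f S| <= C * K Q S *
          (mass (dilate 6 Q) / mass Q + mass (dilate 6 S) / mass S)].

Definition doubling_ball_const (beta0 : R) f C : Prop :=
  [/\ 0 <= C,
      forall B, (0 < mu B)%E -> doubling_ball 6 beta0 B ->
        (mass B)^-1 * \int[mu]_(x in B) `|f x - mean f B| <= C &
      forall Q S, (0 < mu Q)%E -> (0 < mu S)%E ->
        doubling_ball 6 beta0 Q -> doubling_ball 6 beta0 S -> Q `<=` S ->
        `|mean f Q - mean f S| <= C * K Q S].

End rbmo.

(* u and v are comparable functionals on the set D, with constants independent
   of the argument. *)
Definition comparable_on {R : realType} {T : Type} (D : set T) (u v : T -> R) :
    Prop :=
  exists2 A : R, 0 < A & forall f, D f -> A^-1 * v f <= u f <= A * v f.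

(* Main.v *)
(* Given (a), cover a ball B by boundedly many small balls whose rho-dilates
   stay in 6B and compare the corresponding numbers with that of 6B: the
   coefficients K are bounded, so the mean deviation from f_B is controlled by
   the measure of 6B, and (b) follows from the triangle inequality. (b)
   implies (c) because the ratios of measures are at most beta0 for doubling
   balls.
   Given (c), let f_B be the mean of f over the smallest doubling ball S of the
   form 6^k B. Since beta0 beats the growth rate of lambda, the shells between
   B and S contribute a convergent geometric series to K. To bound the
   deviation on B, stop at the largest doubling ball of the form B(x, 216^-k s)
   around each point x of B. The points at which no such ball has radius at
   least 216^-m s are covered by about N^(3 m log2 6) balls of measure at most
   about beta0^-m, so the integral of |f - f_B| near them tends to 0 with m. On
   the others, a finite Vitali selection gives disjoint balls B_i such that the
   balls 6 B_i cover, are doubling and have measure at most beta0 times that of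
   B_i; the means over them differ from f_B by a bounded multiple of the
   constant of (c), as K is bounded between B_i and B. *)
Require Import Defs.
From HB Require Import structures.
From mathcomp Require Import all_boot all_order all_algebra.
From mathcomp Require Import all_classical all_reals all_analysis.
From mathcomp Require Import measurable_realfun ring lra.

Set Implicit Arguments.
Unset Strict Implicit.
Unset Printing Implicit Defensive.

Import Order.TTheory GRing.Theory Num.Theory.
Import numFieldNormedType.Exports.

Local Open Scope classical_set_scope.
Local Open Scope ring_scope.

(* MathComp exports another center and another radius. *)
Local Notation center := Defs.center.
Local Notation radius := Defs.radius.

(** * Integrals, powers and infima *)

Section real_integrals.
Context {d : measure_display} {T : measurableType d} {R : realType}.
Context (mu : {measure set T -> \bar R}).
Implicit Types (A B E : set T) (h : T -> R).

Lemma integrable_cst_fin A (c : R) : measurable A -> (mu A < +oo)%E ->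
  mu.-integrable A (EFin \o cst c).
Proof.
move=> mA Afin; apply/integrableP; split; first by apply/measurable_EFinP;
  exact: measurable_cst.
by rewrite /= integral_cst// lte_mul_pinfty// fin_num_abs.
Qed.

Lemma subset_Rintegral A B h : measurable A -> measurable B -> A `<=` B ->
  (forall x, B x -> 0 <= h x) -> mu.-integrable B (EFin \o h) ->
  \int[mu]_(x in A) h x <= \int[mu]_(x in B) h x.
Proof.
move=> mA mB AB h0 ih; apply: fine_le.
- by apply: integrable_fin_num => //; exact: integrableS ih.
- exact: integrable_fin_num.
- by apply: ge0_subset_integral => //; exact: measurable_int ih.
Qed.

Lemma Rintegral_le_cst A h (c : R) : measurable A -> (mu A < +oo)%E ->
  mu.-integrable A (EFin \o h) -> (forall x, A x -> h x <= c) ->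
  \int[mu]_(x in A) h x <= c * fine (mu A).
Proof.
move=> mA Afin ih hc; rewrite -Rintegral_cst//.
by apply: le_Rintegral => //; exact: integrable_cst_fin.
Qed.

Lemma Rintegral_cover (I : Type) (s : seq I) (P : pred I) (F : I -> set T) A E
    h :
  measurable A -> measurable E -> (forall i, measurable (F i)) ->
  A `<=` E -> (forall i, P i -> F i `<=` E) ->
  (forall x, E x -> 0 <= h x) -> mu.-integrable E (EFin \o h) ->
  A `<=` \big[setU/set0]_(i <- s | P i) F i ->
  \int[mu]_(x in A) h x <= \sum_(i <- s | P i) \int[mu]_(x in F i) h x.
Proof.
move=> mA mE mF AE FE h0 ih; elim: s A mA AE => [|i s IH] A mA AE.
  by rewrite !big_nil subset0 => ->; rewrite Rintegral_set0.
rewrite !big_cons; case: ifPn => Pi; last exact: IH.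
move=> Acov.
have mAF := measurableI _ _ mA (mF i); have mAD := measurableD mA (mF i).
rewrite -(setUIDK A (F i)) Rintegral_setU//; last 2 first.
- by rewrite setUIDK; exact: (integrableS mE).
- by apply/disj_setPS => x [[_ ?] []].
apply: lerD.
- apply: subset_Rintegral => //.
  + by move=> x Fx; apply: h0; exact: (FE i).
  + by apply: (integrableS mE) => //; exact: FE.
- apply: IH => //; first by move=> x [/AE].
  by move=> x [/Acov[Fx nFx//|]].
Qed.

Lemma Rintegral_small E h (e : R) : measurable E ->
  mu.-integrable E (EFin \o h) -> 0 < e ->
  exists2 d : R, 0 < d & forall A, measurable A -> A `<=` E ->
    (mu A < d%:E)%E -> \int[mu]_(x in A) `|h x| < e.
Proof.
move=> mE ih e0.
have ihE : mu.-integrable setT (EFin \o (h \_ E)).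
  by rewrite -restrict_EFin; apply/integrable_restrict => //=; rewrite setTI.
have [r [r0 H]] := integral_normr_continuous ihE e0.
exists r => // A mA AE Ar; have := H A mA Ar.
congr (_ < e); apply: eq_Rintegral => x; rewrite inE => Ax.
by rewrite patchE mem_set//; exact: AE.
Qed.

End real_integrals.

Section powers_of_two.
Context {R : realType}.
Implicit Types (c : R) (j m : nat).

Let ln2_gt0 : 0 < ln (2 : R).
Proof. by apply: ln_gt0; lra. Qed.

Lemma log2_ge0 c : 1 <= c -> 0 <= log2 c.
Proof. by move=> c1; apply: divr_ge0; [exact: ln_ge0|exact: ltW]. Qed.

Lemma powR_log2 c : 0 < c -> 2 `^ (log2 c) = c.
Proof.
by move=> c0; rewrite /powR pnatr_eq0/= /log2 divfK ?gt_eqF// lnK.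
Qed.

Lemma powR_log2C (a b : R) : 0 < a -> 0 < b -> a `^ log2 b = b `^ log2 a.
Proof.
move=> a0 b0; rewrite /powR !gt_eqF//; congr expR.
by rewrite /log2 mulrAC [RHS]mulrAC; congr (_ / _); rewrite mulrC.
Qed.

Lemma pow216_le_pow2 c j : 1 <= c -> exists2 m : nat,
  (216 : R) ^+ j <= 2 ^+ m & c ^+ m <= c * (c `^ (3 * log2 6)) ^+ j.
Proof.
move=> c1; set a := 3 * log2 6 : R.
have a0 : 0 <= a by rewrite mulr_ge0 ?log2_ge0//; lra.
have aj0 : 0 <= a * j%:R by rewrite mulr_ge0.
exists (Num.truncn (a * j%:R)).+1.
- have -> : (216 : R) ^+ j = 2 `^ (a * j%:R).
    rewrite powRrM powR_mulrn ?powR_ge0//; congr (_ ^+ _).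
    rewrite /a mulrC powRrM powR_log2//.
    by rewrite powR_mulrn//; ring.
  rewrite -powR_mulrn//; apply: ler_powR; first lra.
  by rewrite ltW// truncnS_gt.
- rewrite exprS ler_pM2l; last lra.
  rewrite -(powR_mulrn _ (powR_ge0 _ _)) -powRrM -powR_mulrn; last lra.
  by apply: ler_powR => //; rewrite truncn_le.
Qed.

Lemma geometric_lt (q e : R) : 0 <= q -> q < 1 -> 0 < e ->
  exists m : nat, q ^+ m < e.
Proof.
move=> q0 q1 e0; have : `|q| < 1 by rewrite ger0_norm.
move=> /cvg_expr/cvgrPdist_lt/(_ _ e0)[m _ /(_ m (leqnn m))].
by rewrite sub0r normrN ger0_norm ?exprn_ge0//; exists m.
Qed.

Lemma nat_pow2_ge (x : R) : exists m : nat, x <= 2 ^+ m.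
Proof.
have [m xm] : exists m : nat, x <= m%:R.
  by exists (Num.truncn x).+1; rewrite ltW// truncnS_gt.
exists m; apply: (le_trans xm).
by rewrite -natrX ler_nat ltnW// ltn_expl.
Qed.

End powers_of_two.

Section infima.
Context {R : realType}.
Implicit Types (S T : set R) (A : R).

Lemma inf_ge0 S : (forall C, S C -> 0 <= C) -> S !=set0 -> 0 <= inf S.
Proof. by move=> S0 Sne; apply: lb_le_inf. Qed.

Lemma inf_le_scale S T A : 0 <= A -> S !=set0 -> (forall C, S C -> 0 <= C) ->
  (forall C, T C -> 0 <= C) -> (forall C, S C -> T (A * C)) ->
  inf T <= A * inf S.
Proof.
move=> A0 Sne S0 T0 ST; apply/ler_addgt0Pr => e e0.
have A1 : 0 < A + 1 by rewrite ltr_wpDl.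
have infS : has_inf S by split => //; exists 0.
have [C SC Ce] := inf_adherent (divr_gt0 e0 A1) infS.
apply: (@le_trans _ _ (A * C)); first by apply: ge_inf; [exists 0|exact: ST].
apply: (@le_trans _ _ (A * (inf S + e / (A + 1)))).
  by rewrite ler_wpM2l// ltW.
rewrite mulrDr lerD2l mulrA ler_pdivrMr// mulrC ler_wpM2l ?(ltW e0)//.
by rewrite lerDl.
Qed.

Lemma comparable_inf (T : Type) (D : set T) (P Q : T -> R -> Prop) (A B : R) :
  0 <= A -> 0 <= B -> (forall f C, P f C -> 0 <= C) ->
  (forall f C, Q f C -> 0 <= C) ->
  (forall f C, D f -> Q f C -> P f (A * C)) ->
  (forall f C, D f -> P f C -> Q f (B * C)) ->
  (forall f, D f -> exists C, Q f C) ->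
  comparable_on D (fun f => inf [set C | P f C]) (fun f => inf [set C | Q f C]).
Proof.
move=> A0 B0 P0 Q0 QP PQ ne.
have AB : 0 < A + B + 1 by rewrite ltr_wpDl// addr_ge0.
exists (A + B + 1) => // f Df; have [C QC] := ne f Df.
have Qne : [set C | Q f C] !=set0 by exists C.
have Pne : [set C | P f C] !=set0 by exists (A * C); exact: QP.
have u0 := inf_ge0 (P0 f) Pne; have v0 := inf_ge0 (Q0 f) Qne.
have uv := inf_le_scale A0 Qne (Q0 f) (P0 f) (fun C => QP f C Df).
have vu := inf_le_scale B0 Pne (P0 f) (Q0 f) (fun C => PQ f C Df).
apply/andP; split.
- rewrite ler_pdivrMl//; apply: (le_trans vu); apply: ler_wpM2r => //; lra.
- by apply: (le_trans uv); apply: ler_wpM2r => //; lra.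
Qed.

Lemma inf_setT : inf [set: R] = 0.
Proof.
apply: inf_out => -[_ [x xlb]].
by have := xlb (x - 1) I; lra.
Qed.

Lemma inf_nneg : inf [set C : R | 0 <= C] = 0.
Proof.
apply/eqP; rewrite eq_le; apply/andP; split.
  by apply: ge_inf => /=; [exists 0|].
by apply: lb_le_inf; [exists 0 => /=|].
Qed.

End infima.

(** * Balls in metric spaces *)

Section metric_balls.
Context {R : realType} {X : metricType R}.
Implicit Types (x y z : X) (r : R).

Lemma ballP x r y : ball x r y <-> mdist x y < r.
Proof. by rewrite ballEmdist. Qed.

Lemma subset_ball x y r r' : mdist x y + r <= r' -> ball x r `<=` ball y r'.
Proof.
move=> h z /ballP xz; apply/ballP; apply: lt_le_trans h.
rewrite (metric_sym x y); apply: (le_lt_trans (metric_triangle y x z)).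
by rewrite ltrD2l.
Qed.

Lemma subset_ball_center x r r' : r <= r' -> ball x r `<=` ball x r'.
Proof. by move=> h; apply: subset_ball; rewrite mdistxx add0r. Qed.

Lemma ball_meet x y r r' : ball x r `&` ball y r' !=set0 -> mdist x y < r + r'.
Proof.
move=> [z [/ballP xz /ballP yz]].
apply: (le_lt_trans (metric_triangle x z y)).
by rewrite (metric_sym z y) ltrD.
Qed.

Lemma open_ball x r : open (ball x r).
Proof.
rewrite openE => y /ballP xy; apply/nbhs_ballP.
exists (r - mdist x y) => /=; first by rewrite subr_gt0.
by apply: subset_ball; rewrite metric_sym; lra.
Qed.

Lemma vitali_list (rad : X -> R) (s : seq X) : exists s' : seq X,
  [/\ {subset s' <= s},
      pairwise (fun x y => `[< ball x (rad x) `&` ball y (rad y) = set0 >]) s' &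
      forall x, x \in s -> 0 < rad x ->
        exists y, [/\ y \in s', rad x <= rad y & mdist x y < rad x + rad y]].
Proof.
pose le := fun x y => rad x <= rad y.
have le_tr : transitive le by move=> ? ? ?; exact: le_trans.
have : sorted le (sort le s).
  by apply: sort_sorted => x y; exact: le_total.
suff: forall t, sorted le t -> exists s' : seq X,
  [/\ {subset s' <= t},
      pairwise (fun x y => `[< ball x (rad x) `&` ball y (rad y) = set0 >]) s' &
      forall x, x \in t -> 0 < rad x ->
        exists y, [/\ y \in s', rad x <= rad y & mdist x y < rad x + rad y]].
  move=> H /H[s' [s's ps' cs']]; exists s'; split => //.
  - by move=> x /s's; rewrite mem_sort.
  - by move=> x xs; apply: cs'; rewrite mem_sort.
elim => [_|x t IH pt]; first by exists nil.
have /IH[s' [s't ps' cs']] : sorted le t by exact: path_sorted pt.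
have xt : forall y, y \in t -> rad x <= rad y.
  by move=> y; move: y; apply/allP; exact: order_path_min pt.
have [[y [ys' yx]]|nex] :=
  pselect (exists y, y \in s' /\ ball x (rad x) `&` ball y (rad y) !=set0).
- exists s'; split => //; first by move=> z /s't zt; rewrite inE zt orbT.
  move=> z; rewrite inE => /predU1P[->|]; last exact: cs'.
  by move=> _; exists y; split => //; [exact/xt/s't|exact: ball_meet].
- exists (x :: s'); split => /=.
  + move=> z; rewrite !inE => /predU1P[->|/s't ->]; first by rewrite eqxx.
    by rewrite orbT.
  + rewrite ps' andbT; apply/allP => y ys'; apply/asboolP.
    apply/eqP; apply: contrapT => /negP/set0P xy0.
    by apply: nex; exists y.
  + move=> z; rewrite inE => /predU1P[-> x0|zt z0].
      by exists x; split; rewrite ?inE ?eqxx ?mdistxx//; lra.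
    by have [y [ys' ? ?]] := cs' _ zt z0; exists y; rewrite inE ys' orbT.
Qed.

End metric_balls.

(** * Shells and coefficients *)

Section upper_doubling_measure.
Context {d : measure_display} {R : realType} {X : measurableMetricType d R}.
Context (mu : {measure set X -> \bar R}) (lam : X -> R -> R) (Clam Ccmp : R).
Hypothesis borelX : borel_measurable X.
Hypothesis ud : upper_doubling mu lam Clam.
Hypothesis lam_cmp : forall x y r, 0 < r -> mdist x y <= r ->
  lam x r <= Ccmp * lam y r.
Implicit Types (x y z : X) (r s t u : R).

Lemma measurable_ball x r : measurable (ball x r).
Proof.
rewrite borelX; apply: sub_sigma_algebra; exact: open_ball.
Qed.
Local Hint Resolve measurable_ball : core.

Let lam_gt0 x r : 0 < r -> 0 < lam x r. Proof. by case: ud => + _ _ _ _;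
  apply. Qed.
Let lam_homo x r s : 0 < r -> r <= s -> lam x r <= lam x s.
Proof. by case: ud => _ + _ _ _; apply. Qed.
Let lam2 x r : 0 < r -> lam x (2 * r) <= Clam * lam x r.
Proof. by case: ud => _ _ + _ _; apply. Qed.
Let mu_lam x r : 0 < r -> (mu (ball x r) <= (lam x r)%:E)%E.
Proof. by case: ud => _ _ _ + _; apply. Qed.

Lemma mu_ball_fin x r : (mu (ball x r) < +oo)%E.
Proof.
apply: le_lt_trans (ltry (lam x (Num.max 1 r))).
apply: le_trans (mu_lam x _); last by rewrite lt_max ltr01.
apply: le_measure; rewrite ?inE//; apply: subset_ball_center.
by rewrite le_max lexx orbT.
Qed.
Local Hint Resolve mu_ball_fin : core.

Lemma mu_sub_fin (A : set X) x r : measurable A -> A `<=` ball x r ->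
  (mu A < +oo)%E.
Proof. by move=> mA AB; apply: le_lt_trans (mu_ball_fin x r);
  apply: le_measure; rewrite ?inE. Qed.

Lemma mass_ge0 (A : set X) : 0 <= mass mu A.
Proof. exact: fine_ge0. Qed.

Lemma massE (A : set X) : (mu A < +oo)%E -> (mass mu A)%:E = mu A.
Proof. by move=> Afin; rewrite fineK// ge0_fin_numE. Qed.

Lemma mass_gt0 (A : set X) : (mu A < +oo)%E -> (0 < mu A)%E -> 0 < mass mu A.
Proof. by move=> Afin A0; rewrite -lte_fin massE. Qed.

Lemma mass_le (A B : set X) : measurable A -> measurable B -> (mu B < +oo)%E ->
  A `<=` B -> mass mu A <= mass mu B.
Proof.
move=> mA mB Bfin AB; have AB' : (mu A <= mu B)%E by apply: le_measure;
  rewrite ?inE.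
by rewrite -lee_fin !massE//; exact: le_lt_trans Bfin.
Qed.

Lemma mass_ball_le x y r s : mdist x y + r <= s ->
  mass mu (ball x r) <= mass mu (ball y s).
Proof. by move=> h; apply: mass_le => //; exact: subset_ball. Qed.

Lemma mass_ball_lam x r : 0 < r -> mass mu (ball x r) <= lam x r.
Proof. by move=> r0; rewrite -lee_fin massE//; exact: mu_lam. Qed.

Lemma mass_disjoint_le (F : X -> set X) (s : seq X) (V : set X) :
  (forall y, measurable (F y)) -> measurable V -> (mu V < +oo)%E ->
  (forall y, y \in s -> F y `<=` V) ->
  pairwise (fun y z => `[< F y `&` F z = set0 >]) s ->
  \sum_(y <- s) mass mu (F y) <= mass mu V.
Proof.
move=> mF; elim: s V => [|y s IH] V mV Vfin FV;
  first by rewrite big_nil mass_ge0.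
rewrite /= => /andP[/allP ys ps]; rewrite big_cons.
have yV : F y `<=` V by apply: FV; rewrite inE eqxx.
have mVy := measurableD mV (mF y).
have Vyfin : (mu (V `\` F y) < +oo)%E.
  apply: le_lt_trans Vfin; apply: le_measure; rewrite ?inE//; exact: subDsetl.
have yfin : (mu (F y) < +oo)%E.
  by apply: le_lt_trans Vfin; apply: le_measure; rewrite ?inE.
have -> : mass mu V = mass mu (F y) + mass mu (V `\` F y).
  apply: EFin_inj; rewrite EFinD !massE// -measureU//.
  - by rewrite setDUK.
  - by rewrite setDE setICA setICr setI0.
rewrite lerD2l; apply: IH => // z zs w Fzw; split.
  by apply: (FV z) => //; rewrite inE zs orbT.
move=> Fyw; have /asboolP := ys z zs.
by rewrite -subset0; apply; split; [exact: Fyw|exact: Fzw].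
Qed.

Lemma lam_pow2 x r m : 0 < r -> lam x (2 ^+ m * r) <= Clam ^+ m * lam x r.
Proof.
move=> r0.
have C1 : 0 <= Clam.
  have := lam2 x r0 => h; rewrite -(pmulr_lge0 _ (lam_gt0 x r0)).
  by apply: le_trans h; rewrite ltW// lam_gt0// mulr_gt0.
elim: m => [|m IH]; first by rewrite !expr0 !mul1r.
rewrite !exprS -!mulrA; apply: le_trans (lam2 x _) _; last exact: ler_wpM2l.
by rewrite mulr_gt0// exprn_gt0.
Qed.

Lemma Clam_ge1 x : 1 <= Clam.
Proof.
have l1 := lam_gt0 x ltr01; rewrite -(ler_pM2r l1) mul1r.
by apply: le_trans (lam2 x ltr01); apply: lam_homo => //; lra.
Qed.

Lemma Ccmp_ge1 x : 1 <= Ccmp.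
Proof.
have l1 := lam_gt0 x ltr01; rewrite -(ler_pM2r l1) mul1r.
by apply: lam_cmp => //; rewrite mdistxx.
Qed.

Lemma lam_pow216 x r j : 0 < r ->
  lam x (216 ^+ j * r) <= Clam * (Clam `^ (3 * log2 6)) ^+ j * lam x r.
Proof.
move=> r0; have [m m1 m2] := pow216_le_pow2 j (Clam_ge1 x).
apply: (@le_trans _ _ (lam x (2 ^+ m * r))).
  by apply: lam_homo; [rewrite mulr_gt0// exprn_gt0|rewrite ler_pM2r].
apply: le_trans (lam_pow2 _ _ r0) _.
by rewrite ler_wpM2r// ltW// lam_gt0.
Qed.

Definition shell x s t : set X := [set z | s <= mdist z x <= t].

Definition shell_int x s t : R := \int[mu]_(z in shell x s t)
  (lam x (mdist z x))^-1.

Lemma measurable_mdist x : measurable_fun setT (fun z => mdist z x).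
Proof.
apply: (measurability _ (RGenInftyO.measurableE R)) => // _ [_ [r ->] <-].
rewrite setTI (_ : _ @^-1` _ = ball x r)//.
by apply/seteqP; split => z /=; rewrite in_itv/= ballEmdist/= metric_sym.
Qed.

Lemma measurable_shell x s t : measurable (shell x s t).
Proof.
rewrite (_ : shell x s t = setT `&` (fun z => mdist z x) @^-1` `[s, t]).
  exact: (measurable_mdist x).
by apply/seteqP; split => z /=; rewrite /shell/= in_itv//= => -[].
Qed.
Local Hint Resolve measurable_shell : core.

Lemma shell_sub_ball x s t r : t < r -> shell x s t `<=` ball x r.
Proof.
move=> tr z /andP[_ zt]; apply/ballP; rewrite metric_sym.
exact: le_lt_trans tr.
Qed.

Lemma mu_shell_fin x s t : (mu (shell x s t) < +oo)%E.
Proof.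
by apply: (@mu_sub_fin _ x (t + 1)) => //; apply: shell_sub_ball; rewrite ltrDl.
Qed.
Local Hint Resolve mu_shell_fin : core.

Lemma inv_lam_le x s u : 0 < s -> s <= u -> (lam x u)^-1 <= (lam x s)^-1.
Proof.
move=> s0 su; rewrite lef_pV2 ?posrE ?lam_gt0//; first exact: lam_homo.
exact: lt_le_trans su.
Qed.

Lemma integrable_shell_radial x s t : 0 < s ->
  mu.-integrable (shell x s t) (EFin \o (fun z => (lam x (mdist z x))^-1)).
Proof.
move=> s0.
apply: (@le_integrable _ _ _ _ _ _ _ (EFin \o cst (lam x s)^-1)) => //.
- apply/measurable_EFinP.
  apply: (@eq_measurable_fun _ _ _ _ _
      ((fun r => (lam x (Num.max s r))^-1) \o (fun z => mdist z x))).
    by move=> z; rewrite inE => /andP[sz _] /=; rewrite max_r.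
  apply: measurableT_comp.
    apply: nonincreasing_measurable => // a b ab.
    apply: inv_lam_le; first by rewrite lt_max s0.
    by rewrite ge_max !le_max lexx/= ab orbT.
  exact: measurable_funS (measurable_mdist x).
- move=> z /andP[sz _] /=; rewrite lee_fin.
  have z0 : 0 < mdist z x by exact: lt_le_trans sz.
  by rewrite !gtr0_norm ?invr_gt0 ?lam_gt0// inv_lam_le.
- exact: integrable_cst_fin.
Qed.

Lemma shell_int_ge0 x s t : 0 < s -> 0 <= shell_int x s t.
Proof.
move=> s0; apply: Rintegral_ge0 => z /andP[sz _].
by rewrite invr_ge0 ltW// lam_gt0//; exact: lt_le_trans sz.
Qed.

Lemma shell_int_subset x s t s' t' : 0 < s -> s <= s' -> t' <= t ->
  shell_int x s' t' <= shell_int x s t.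
Proof.
move=> s0 ss tt; apply: subset_Rintegral => //.
- move=> z /andP[sz zt]; apply/andP; split; first exact: le_trans sz.
  exact: le_trans tt.
- move=> z /andP[sz _]; rewrite invr_ge0 ltW// lam_gt0//; exact: lt_le_trans sz.
- exact: integrable_shell_radial.
Qed.

Lemma shell_int_cat x s t u : 0 < s -> 0 < u ->
  shell_int x s t <= shell_int x s u + shell_int x u t.
Proof.
move=> s0 u0.
have m0 : 0 < Num.min s u by rewrite lt_min s0.
pose F (b : bool) := if b then shell x s u else shell x u t.
have := @Rintegral_cover _ _ _ mu bool [:: true; false] predT F (shell x s t)
  (shell x (Num.min s u) (Num.max t u)) (fun z => (lam x (mdist z x))^-1).
rewrite !big_cons !big_nil addr0 setU0; apply => //.
- by case; exact: measurable_shell.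
- move=> z /andP[sz zt]; apply/andP; split.
    by rewrite ge_min sz.
  by rewrite le_max zt.
- case=> _ z /andP[sz zt]; apply/andP; split.
  + by rewrite ge_min sz.
  + by rewrite le_max zt orbT.
  + by rewrite ge_min sz orbT.
  + by rewrite le_max zt.
- move=> z /andP[sz _]; rewrite invr_ge0 ltW// lam_gt0//; exact: lt_le_trans sz.
- exact: integrable_shell_radial.
- move=> z /andP[sz zt]; have [zu|uz] := leP (mdist z x) u.
    by left; apply/andP; split.
  by right; apply/andP; split => //; exact: ltW.
Qed.

Lemma shell_int_mass x s t r : 0 < s -> t < r ->
  shell_int x s t <= mass mu (ball x r) / lam x s.
Proof.
move=> s0 tr; rewrite mulrC.
apply: (@le_trans _ _ ((lam x s)^-1 * mass mu (shell x s t))).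
  apply: Rintegral_le_cst => //; first exact: integrable_shell_radial.
  by move=> z /andP[sz _]; exact: inv_lam_le.
rewrite ler_wpM2l ?invr_ge0 ?(ltW (lam_gt0 _ _))//.
by apply: mass_le => //; exact: shell_sub_ball.
Qed.

Lemma shell_int_ratio x s t m : 0 < s -> t <= 2 ^+ m * s ->
  shell_int x s t <= Clam ^+ m.+1.
Proof.
move=> s0 ts.
have h : t < 2 ^+ m.+1 * s.
  apply: le_lt_trans ts _; rewrite ltr_pM2r// exprS.
  by rewrite ltr_pMl ?exprn_gt0//; lra.
apply: le_trans (shell_int_mass x s0 h) _.
rewrite ler_pdivrMr ?lam_gt0//.
apply: le_trans (lam_pow2 x _ s0).
by apply: mass_ball_lam; rewrite mulr_gt0// exprn_gt0.
Qed.

(* On the outer part of the shell the distances to x and to y differ at most by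
   a factor 3/2. *)
Lemma shell_int_center x y s t : 0 < s -> mdist x y <= s ->
  shell_int x s t <= (Clam ^+ 2 + Clam ^+ 3 * Ccmp) * (1 + shell_int y s t).
Proof.
move=> s0 xy; have C1 := Clam_ge1 x; have C0 := le_trans ler01 C1.
have D1 := Ccmp_ge1 x; have D0 := le_trans ler01 D1.
have Js := shell_int_ge0 y t s0.
have [t0|t0] := leP t s.
  apply: (@le_trans _ _ (Clam ^+ 1)).
    by apply: shell_int_ratio => //; rewrite expr0 mul1r.
  rewrite expr1; have : Clam <= Clam ^+ 2 by rewrite expr2 ler_peMl.
  have : 0 <= Clam ^+ 3 * Ccmp by rewrite mulr_ge0 ?exprn_ge0.
  nra.
have tp : 0 < t by exact: lt_trans t0.
apply: le_trans (@shell_int_cat x s t (2 * s) s0 _) _;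
  first by rewrite mulr_gt0.
have s20 : 0 < 2 * s by rewrite mulr_gt0.
have h1 : shell_int x s (2 * s) <= Clam ^+ 2.
  by apply: shell_int_ratio => //; rewrite expr1.
suff h2 : shell_int x (2 * s) t <= Clam * Ccmp * shell_int y s (2 * t).
  have h3 : shell_int y s (2 * t) <= shell_int y s t + Clam ^+ 2.
    apply: le_trans (shell_int_cat y (2 * t) s0 tp) _; rewrite lerD2l.
    by apply: shell_int_ratio => //; rewrite expr1.
  have CD : 0 <= Clam * Ccmp by rewrite mulr_ge0.
  have CC : Clam <= Clam ^+ 3.
    by rewrite -{1}(expr1 Clam); apply: ler_weXn2l.
  have C2 : 0 <= Clam ^+ 2 by rewrite exprn_ge0.
  have h4 := le_trans h2 (ler_wpM2l CD h3).
  have h5 : Clam * Ccmp * shell_int y s t <= Clam ^+ 3 * Ccmp * shell_int y s t.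
    by rewrite ler_wpM2r// ler_wpM2r.
  apply: le_trans (lerD h1 h4) _.
  rewrite mulrDr [Clam * Ccmp * Clam ^+ 2](_ : _ = Clam ^+ 3 * Ccmp);
    last by ring.
  have : 0 <= Clam ^+ 2 * shell_int y s t by rewrite mulr_ge0.
  nra.
have sub : shell x (2 * s) t `<=` shell y s (2 * t).
  move=> z /andP[sz zt]; have := metric_triangle z x y.
  have := metric_triangle z y x; rewrite (metric_sym y x) => t1 t2.
  by apply/andP; split; lra.
have iy := integrable_shell_radial y (2 * t) s0.
rewrite /shell_int -RintegralZl//.
apply: (@le_trans _ _ (\int[mu]_(z in shell x (2 * s) t)
  (Clam * Ccmp * (lam y (mdist z y))^-1))).
  apply: le_Rintegral => //; first exact: integrable_shell_radial.
    apply: (integrableS (measurable_shell y s (2 * t))) => //.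
    exact: (integrableZl _ _ iy).
  move=> z zs; have /andP[sz zt] := zs; have /andP[sz' _] := sub _ zs.
  have z0 : 0 < mdist z x by exact: lt_le_trans sz.
  have z'0 : 0 < mdist z y by exact: lt_le_trans sz'.
  have Cp := lt_le_trans ltr01 C1; have Dp := lt_le_trans ltr01 D1.
  rewrite -ler_pdivrMl ?mulr_gt0// -invfM.
  rewrite lef_pV2 ?posrE ?lam_gt0//; last by rewrite !mulr_gt0 ?lam_gt0.
  have t1 := metric_triangle z x y.
  apply: (@le_trans _ _ (lam y (2 * mdist z x)));
    first by apply: lam_homo => //; lra.
  apply: le_trans (lam2 _ z0) _; rewrite -mulrA ler_wpM2l//.
  by apply: lam_cmp => //; rewrite metric_sym; lra.
apply: subset_Rintegral => //.
  move=> z /andP[sz _]; rewrite mulr_ge0 ?mulr_ge0// invr_ge0 ltW// lam_gt0//.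
  exact: lt_le_trans sz.
exact: (integrableZl _ _ iy).
Qed.

Context (N : nat) (beta0 : R).
Hypothesis threshold : doubling_threshold N Clam < beta0.

Let D := Clam `^ (3 * log2 6).
Let q := D / beta0.

Let D_lt : D < beta0.
Proof. by move: threshold; rewrite /doubling_threshold gt_max => /andP[]. Qed.

Lemma beta0_gt0 : 0 < beta0.
Proof. by apply: le_lt_trans D_lt; exact: powR_ge0. Qed.

Let D_ge1 (x : X) : 1 <= D.
Proof.
have h : (0 : R) <= 3 * log2 6 by rewrite mulr_ge0// log2_ge0//; lra.
by have := ler_powR (Clam_ge1 x) h; rewrite powRr0.
Qed.

Let q_ge0 : 0 <= q.
Proof. by rewrite divr_ge0 ?powR_ge0// ltW// beta0_gt0. Qed.

Let q_lt1 : q < 1.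
Proof. by rewrite ltr_pdivrMr ?beta0_gt0// mul1r. Qed.

Lemma iter_growth (m : nat -> R) i n :
  (forall j, (i <= j < i + n)%N -> beta0 * m j <= m j.+1) ->
  beta0 ^+ n * m i <= m (i + n)%N.
Proof.
elim: n => [|n IH] H; first by rewrite expr0 mul1r addn0.
rewrite exprS -mulrA addnS; apply: (@le_trans _ _ (beta0 * m (i + n)%N)).
  rewrite ler_wpM2l ?(ltW beta0_gt0)//; apply: IH => j /andP[ij jn].
  by apply: H; rewrite ij addnS ltnS ltnW.
by apply: H; rewrite leq_addr addnS ltnSn.
Qed.

Definition growth_bound : R := Clam + Clam ^+ 9 * beta0 ^+ 2 / (1 - q).

Lemma growth_bound_ge0 x : 0 <= growth_bound.
Proof.
have C1 := le_trans ler01 (Clam_ge1 x).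
by rewrite addr_ge0// divr_ge0 ?mulr_ge0 ?exprn_ge0 ?(ltW beta0_gt0)// subr_ge0
  ltW.
Qed.

(* When the measures of the balls of radii a^j r grow at a rate faster than lam
   can, the contributions of the successive shells decay geometrically inwards
   from the largest one. *)
Lemma shell_int_growth x r a k : 0 < r -> 1 < a -> a <= 216 ->
  (forall j, (j < k)%N ->
    beta0 * mass mu (ball x (a ^+ j * r)) <=
      mass mu (ball x (a ^+ j.+1 * r))) ->
  shell_int x r (a ^+ k * r) <= growth_bound.
Proof.
move=> r0 a1 a216; have b0 := beta0_gt0; have C1 := Clam_ge1 x.
have C0 := le_trans ler01 C1; have b1 : 1 <= beta0.
  exact: le_trans (D_ge1 x) (ltW D_lt).
have a0 : 0 < a := lt_trans ltr01 a1.
set E := Clam ^+ 9 * beta0 ^+ 2.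
have E0 : 0 <= E by rewrite mulr_ge0 ?exprn_ge0// ltW.
have q1 : 0 < 1 - q by rewrite subr_gt0.
suff H : (forall j, (j < k)%N ->
    beta0 * mass mu (ball x (a ^+ j * r)) <=
      mass mu (ball x (a ^+ j.+1 * r))) ->
    shell_int x r (a ^+ k * r) <= Clam + E / (1 - q) * (1 - q ^+ k).
  move=> /H/le_trans; apply; rewrite /growth_bound lerD2l ler_piMr//.
    by rewrite divr_ge0// ltW.
  by rewrite gerBl exprn_ge0.
elim: k r r0 => [|k IH] r r0 H.
  rewrite expr0 subrr mulr0 addr0 -[leRHS]expr1; apply: shell_int_ratio => //.
have ar0 : 0 < a * r by rewrite mulr_gt0.
apply: le_trans (shell_int_cat _ _ r0 ar0) _.
have -> : a ^+ k.+1 * r = a ^+ k * (a * r) by rewrite exprSr mulrA.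
have {}IH : shell_int x (a * r) (a ^+ k * (a * r)) <=
    Clam + E / (1 - q) * (1 - q ^+ k).
  by apply: IH => // j jk; rewrite !mulrA -!exprSr; exact: H.
suff h1 : shell_int x r (a * r) <= E * q ^+ k.+1.
  apply: le_trans (lerD h1 IH) _.
  have -> : E / (1 - q) * (1 - q ^+ k.+1) =
    E * q ^+ k + E / (1 - q) * (1 - q ^+ k).
    by rewrite exprS; field; rewrite gt_eqF.
  by rewrite addrCA lerD2l lerD2r ler_wpM2l// exprS ler_piMl ?exprn_ge0// ltW.
case: k {IH} H => [|k] H.
  apply: (@le_trans _ _ (Clam ^+ 9)).
    apply: shell_int_ratio => //; rewrite ler_pM2r//.
    by apply: le_trans a216 _; rewrite -natrX ler_nat.
  rewrite expr1 /E /q -mulrA ler_peMr ?exprn_ge0//.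
  have -> : beta0 ^+ 2 * (D / beta0) = beta0 * D by field; rewrite gt_eqF.
  by have := D_ge1 x; nra.
have aa : a * r < a ^+ 2 * r.
  by rewrite expr2 ltr_pM2r// ltr_pMr.
apply: le_trans (shell_int_mass x r0 aa) _.
rewrite ler_pdivrMr ?lam_gt0//.
have h2 : beta0 ^+ k * mass mu (ball x (a ^+ 2 * r)) <=
  Clam * D ^+ k.+2 * lam x r.
  have := @iter_growth (fun j => mass mu (ball x (a ^+ j * r))) 2 k.
  rewrite add2n => /(_ _)/le_trans; apply.
    by move=> j /andP[_ jk]; exact: H.
  apply: le_trans (lam_pow216 x k.+2 r0).
  apply: le_trans (mass_ball_lam _ _) _; first by rewrite mulr_gt0// exprn_gt0.
  apply: lam_homo; first by rewrite mulr_gt0// exprn_gt0.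
  by rewrite ler_pM2r//; apply: lerXn2r; rewrite ?nnegrE// ltW.
have bk : 0 < beta0 ^+ k by rewrite exprn_gt0.
rewrite -(ler_pM2l bk); apply: le_trans h2 _.
have -> : beta0 ^+ k * (E * q ^+ k.+2 * lam x r) =
  Clam ^+ 9 * D ^+ k.+2 * lam x r.
  rewrite /E /q expr_div_n.
  have -> : beta0 ^+ k.+2 = beta0 ^+ k * beta0 ^+ 2 by rewrite -exprD addn2.
  move: bk (D ^+ k.+2) (Clam ^+ 9); move: (beta0 ^+ k) => u u0 v w.
  by field; rewrite !gt_eqF.
rewrite ler_wpM2r ?(ltW (lam_gt0 _ _))// ler_wpM2r ?exprn_ge0 ?powR_ge0//.
by rewrite -{1}(expr1 Clam); apply: ler_weXn2l.
Qed.

(** * Doubling hulls *)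

Implicit Types (B Q S P : mball X) (f : X -> R).

(* The number f_B in the definition of RBMO is the mean over a hull of B. *)
Definition doubling_hull B S : Prop :=
  [/\ center S = center B, radius B <= radius S, (0 < mu S)%E,
      doubling_ball mu 6 beta0 S &
      shell_int (center B) (radius B) (radius S) <= growth_bound].

Lemma doubling_ballE (beta : R) B : doubling_ball mu 6 beta B <->
  mass mu (ball (center B) (6 * radius B)) <= beta * mass mu B.
Proof.
rewrite /doubling_ball -lee_fin EFinM massE; last exact: mu_ball_fin.
by rewrite massE//; exact: mu_ball_fin.
Qed.

Lemma exists_doubling_hull (B0 : mball X) B : (0 < mu B0)%E ->
  exists S, doubling_hull B S.
Proof.
move=> B0pos; have b0 := beta0_gt0; have r0 := radius_gt0 B.
set x := center B; set r := radius B.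
pose m k := mass mu (ball x (6 ^+ k * r)).
have rk k : 0 < 6 ^+ k * r by rewrite mulr_gt0// exprn_gt0.
have [k0 mk0] : exists k0, 0 < m k0.
  have [k hk] := nat_pow2_ge ((mdist (center B0) x + radius B0) / r).
  exists k; apply: (@lt_le_trans _ _ (mass mu B0)).
    by apply: mass_gt0 => //; exact: mu_ball_fin.
  apply: mass_ball_le; rewrite -ler_pdivrMr//; apply: le_trans hk _.
  by apply: lerXn2r; rewrite ?nnegrE//; lra.
have exP : exists k, m k.+1 < beta0 * m k.
  apply: contrapT => nP.
  have H k : beta0 * m k <= m k.+1.
    by rewrite leNgt; apply/negP => h; apply: nP; exists k.
  set L := Clam * lam x (6 ^+ k0 * r).
  have L0 : 0 < L by rewrite mulr_gt0 ?lam_gt0//;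
    exact: lt_le_trans (Clam_ge1 x).
  have [n] := @geometric_lt _ q (m k0 / L) q_ge0 q_lt1 (divr_gt0 mk0 L0).
  rewrite ltr_pdivlMr// ltNge => /negP; apply.
  have h1 : beta0 ^+ n * m k0 <= m (k0 + n)%N by apply: iter_growth => j _.
  rewrite expr_div_n mulrAC ler_pdivlMr ?exprn_gt0// mulrC.
  apply: le_trans h1 _; apply: le_trans (mass_ball_lam _ (rk _)) _.
  apply: (@le_trans _ _ (lam x (216 ^+ n * (6 ^+ k0 * r)))).
    apply: lam_homo => //; rewrite exprD -mulrA mulrCA ler_pM2r//.
    by apply: lerXn2r; rewrite ?nnegrE//; lra.
  by apply: le_trans (lam_pow216 x n (rk k0)) _; rewrite /L -!mulrA mulrCA.
have [k Pk kmin] := ex_minnP exP.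
exists (MBall x (rk k)); split => //=.
- by rewrite ler_peMl ?(ltW r0)// exprn_ege1//; lra.
- rewrite -massE; last exact: mu_ball_fin.
  rewrite lte_fin -(pmulr_lgt0 _ b0) mulrC.
  by apply: le_lt_trans Pk; exact: mass_ge0.
- by apply/doubling_ballE; rewrite /= mulrA -exprS; exact: ltW.
- apply: shell_int_growth => //; [lra|lra|] => j jk.
  by rewrite leNgt; apply/negP => /kmin; rewrite leqNgt jk.
Qed.

Lemma KE B Q : K mu lam B Q = 1 + shell_int (center B) (radius B) (radius Q).
Proof. by []. Qed.

Lemma K_ge1 B Q : 1 <= K mu lam B Q.
Proof. by rewrite KE lerDl; exact: shell_int_ge0 (radius_gt0 B). Qed.

Definition center_bound : R := Clam ^+ 2 + Clam ^+ 3 * Ccmp.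

Definition hull_shell_bound (a : R) : R := a + growth_bound + (Clam ^+ 2 +
  growth_bound).

Definition hull_bound (a : R) : R :=
  2 + hull_shell_bound a + center_bound * (1 + hull_shell_bound a).

Lemma center_bound_ge0 x : 0 <= center_bound.
Proof.
have C0 := le_trans ler01 (Clam_ge1 x); have D0 := le_trans ler01 (Ccmp_ge1 x).
by apply: addr_ge0; [exact: exprn_ge0|apply: mulr_ge0 => //; exact: exprn_ge0].
Qed.

Lemma hull_shell_bound_ge0 x (a : R) : 0 <= a -> 0 <= hull_shell_bound a.
Proof.
move=> a0; have C0 := le_trans ler01 (Clam_ge1 x).
have G0 := growth_bound_ge0 x; have := exprn_ge0 2 C0.
by rewrite /hull_shell_bound; move: growth_bound G0 => G ?; lra.
Qed.

Lemma hull_bound_ge0 x (a : R) : 0 <= a -> 0 <= hull_bound a.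
Proof.
move=> a0; have h := hull_shell_bound_ge0 x a0.
have : 0 <= center_bound * (1 + hull_shell_bound a).
  by rewrite mulr_ge0 ?(center_bound_ge0 x)// addr_ge0.
by rewrite /hull_bound; lra.
Qed.

(* Both balls are compared with the hull of a ball around the center of Q
   containing them. *)
Lemma mean_hull_le f (C a : R) P Q S :
  doubling_ball_const mu lam beta0 f C -> 0 <= a ->
  (0 < mu P)%E -> doubling_ball mu 6 beta0 P -> doubling_hull Q S ->
  mdist (center P) (center Q) <= radius Q ->
  shell_int (center Q) (radius Q) (radius P) <= a ->
  `|mean mu f P - mean mu f S| <= C * (hull_bound a *
    (1 + shell_int (center P) (radius P) (radius Q))).
Proof.
move=> [C0 _ fC] a0 Ppos Pdbl [SQ QS Spos Sdbl JS] PQ Ja.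
have rP := radius_gt0 P; have rQ := radius_gt0 Q; have rS := radius_gt0 S.
have G0 := growth_bound_ge0 (center P).
have C1 := le_trans ler01 (Clam_ge1 (center P)).
set T := Num.max (radius P) (radius S).
have T0 : 0 < T by rewrite lt_max rP.
have PT : radius P <= T by rewrite le_max lexx.
have ST : radius S <= T by rewrite le_max lexx orbT.
have T20 : 0 < 2 * T by rewrite mulr_gt0.
have [U [UQ TU Upos Udbl JU]] := exists_doubling_hull (MBall (center Q) T20)
  Ppos.
rewrite /= in UQ TU JU.
have hT : shell_int (center Q) (radius Q) T <= a + growth_bound.
  rewrite /T; have [_|_] := leP (radius P) (radius S).
    by rewrite (le_trans JS)// lerDr.
  by rewrite (le_trans Ja)// lerDl.
have h1 : shell_int (center Q) (radius Q) (radius U) <= hull_shell_bound a.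
  apply: le_trans (shell_int_cat _ _ rQ T0) _; apply: lerD => //.
  apply: le_trans (shell_int_cat _ _ T0 T20) _; apply: lerD => //.
  by apply: shell_int_ratio => //; rewrite expr1.
have PU : P `<=` U.
  by apply: subset_ball; rewrite UQ; lra.
have SU : S `<=` U.
  by apply: subset_ball; rewrite UQ SQ mdistxx; lra.
have hPU : K mu lam P U <= 1 + shell_int (center P) (radius P) (radius Q) +
    center_bound * (1 + hull_shell_bound a).
  rewrite KE -addrA lerD2l; apply: le_trans (shell_int_cat _ _ rP rQ) _.
  rewrite lerD2l; apply: le_trans (shell_int_center _ rQ PQ) _.
  by rewrite ler_wpM2l ?(center_bound_ge0 (center P))// lerD2l.
have hSU : K mu lam S U <= 1 + hull_shell_bound a.
  rewrite KE lerD2l SQ; apply: le_trans h1.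
  exact: shell_int_subset.
have fPU := fC P U Ppos Upos Pdbl Udbl PU.
have fSU := fC S U Spos Upos Sdbl Udbl SU.
rewrite (_ : mean mu f P - _ =
  (mean mu f P - mean mu f U) - (mean mu f S - mean mu f U));
  last by ring.
apply: le_trans (ler_normB _ _) _; apply: le_trans (lerD fPU fSU) _.
rewrite -mulrDr ler_wpM2l//; apply: le_trans (lerD hPU hSU) _.
have J0 := shell_int_ge0 (center P) (radius Q) rP.
have A0 := hull_shell_bound_ge0 (center P) a0.
have := center_bound_ge0 (center P); rewrite /hull_bound.
move: (center_bound) (hull_shell_bound a) A0 J0 => c h h0.
move: (shell_int _ _ _) => J J0 c0.
have ch : 0 <= c * (1 + h) by rewrite mulr_ge0// addr_ge0.
have e1 : 0 <= (1 + h + c * (1 + h)) * J by rewrite mulr_ge0// !addr_ge0.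
lra.
Qed.

Lemma hull_shell_sub B Q S : B `<=` Q -> doubling_hull B S ->
  shell_int (center Q) (radius Q) (radius S) <=
    Clam ^+ 2 + center_bound * (1 + growth_bound).
Proof.
move=> BQ [SB BS _ _ JS].
have rB := radius_gt0 B; have rQ := radius_gt0 Q.
have C1 := le_trans ler01 (Clam_ge1 (center Q)).
have A0 := center_bound_ge0 (center Q).
have : ball (center Q) (radius Q) (center B).
  by apply: BQ; apply/ballP; rewrite mdistxx.
move=> /ballP QB; have QB' := ltW QB.
have [BleQ|QltB] := leP (radius B) (radius Q).
  apply: le_trans (shell_int_center _ rQ QB') _.
  rewrite ler_wpDl ?exprn_ge0// ler_wpM2l// lerD2l; apply: le_trans JS.
  exact: shell_int_subset.
apply: le_trans (shell_int_cat _ _ rQ rB) _; apply: lerD; last first.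
  apply: le_trans (shell_int_center _ rB _) _.
    exact: le_trans QB' (ltW QltB).
  by rewrite ler_wpM2l// lerD2l.
have rB2 : 0 < radius B / 2 by rewrite divr_gt0.
(* B `<=` Q does not bound the radius of B by that of Q, but a point outside Q
   is outside B, hence far from the center of Q. *)
have sub : shell (center Q) (radius Q) (radius B) `<=`
    shell (center Q) (radius B / 2) (radius B).
  move=> z /andP[Qz zB]; apply/andP; split => //; rewrite leNgt;
    apply/negP => zB2.
  have : ball (center Q) (radius Q) z.
    apply: BQ; apply/ballP;
      apply: le_lt_trans (metric_triangle _ (center Q) _) _.
    by rewrite (metric_sym (center B)) (metric_sym _ z); lra.
  by move=> /ballP; rewrite metric_sym ltNge Qz.
apply: (@le_trans _ _ (shell_int (center Q) (radius B / 2) (radius B))).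
  apply: subset_Rintegral => //; last exact: integrable_shell_radial.
  move=> z /andP[sz _]; rewrite invr_ge0 ltW// lam_gt0//; exact: lt_le_trans sz.
by apply: shell_int_ratio => //; rewrite expr1 mulrC divfK.
Qed.

(** * Covering by small doubling balls *)

Hypothesis doublingX : geometrically_doubling X N.

Lemma cover_pow2 x r p : 0 < r -> exists2 s : seq X, (size s <= N ^ p)%N &
  ball x r `<=` \bigcup_(y in [set` s]) ball y (r / 2 ^+ p).
Proof.
move=> r0; elim: p => [|p [s sN xs]].
  exists [:: x] => // y xy; exists x; first by rewrite /= inE.
  by rewrite expr0 divr1.
have rp : 0 < r / 2 ^+ p by rewrite divr_gt0// exprn_gt0.
have /choice[g gP] : forall y, exists t : seq X, (size t <= N)%N /\
    ball y (r / 2 ^+ p) `<=` \bigcup_(z in [set` t]) ball z (r / 2 ^+ p / 2).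
  by move=> y; have [t tN yt] := doublingX y rp; exists t.
exists (flatten [seq g y | y <- s]).
  rewrite size_flatten /shape -map_comp expnSr.
  apply: (@leq_trans (size s * N)%N); last by rewrite leq_mul2r sN orbT.
  elim: s {sN xs} => //= y s IH; rewrite mulSn leq_add//.
  by have [] := gP y.
move=> z /xs[y /= ys yz]; have [_ /(_ _ yz)[w /= wg wz]] := gP y.
exists w => /=; last by rewrite exprSr invfM mulrA.
by apply/flattenP; exists (g y) => //; apply/mapP; exists y.
Qed.

Let N_gt0 (x : X) : (0 < N)%N.
Proof.
have [s sN /(_ x)] := doublingX x (ltr01 : 0 < 1 :> R).
case; first by apply/ballP; rewrite mdistxx.
move=> y /=; case: s sN => // a s sN _ _; exact: leq_trans sN.
Qed.

Let Dn : R := N%:R `^ (3 * log2 6).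

Let Dn_lt x : Dn < beta0.
Proof.
have N0 : 0 < N%:R :> R by rewrite ltr0n (N_gt0 x).
have -> : Dn = 6 `^ (3 * log2 N%:R).
  rewrite /Dn (mulrC 3 (log2 6)) (mulrC 3 (log2 _)).
  by rewrite (powRrM _ (log2 6)) (powRrM _ (log2 _)) powR_log2C.
by move: threshold; rewrite /doubling_threshold gt_max => /andP[].
Qed.

Lemma mass_cover_le (I : Type) (s : seq I) (F : I -> set X) (A : set X) x r :
  measurable A -> (forall i, measurable (F i)) ->
  A `<=` ball x r -> (forall i, F i `<=` ball x r) ->
  A `<=` \big[setU/set0]_(i <- s) F i ->
  mass mu A <= \sum_(i <- s) mass mu (F i).
Proof.
move=> mA mF Ax Fx Acov.
have mE (V : set X) : measurable V ->
  mass mu V = \int[mu]_(z in V) (cst 1 : X -> R) z.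
  by move=> mB; rewrite Rintegral_cst// mul1r.
rewrite mE// (eq_bigr (fun i => \int[mu]_(z in F i) (cst 1 : X -> R) z)).
  by apply: (Rintegral_cover mA (measurable_ball x r)) => //;
    exact: integrable_cst_fin.
by move=> i _; rewrite mE.
Qed.

Let scale (s : R) (k : nat) : R := s / 216 ^+ k.

Let pos216 : 0 < 216 :> R. Proof. by rewrite ltr0n. Qed.

Let scale_gt0 s k : 0 < s -> 0 < scale s k.
Proof. by move=> s0; apply: divr_gt0 => //; exact: exprn_gt0. Qed.

Let scale0 s : scale s 0 = s. Proof. by rewrite /scale expr0 divr1. Qed.

Let scaleM s j k : (j <= k)%N -> 216 ^+ j * scale s k = scale s (k - j).
Proof.
move=> jk; rewrite /scale -{1}(subnK jk) exprD; field.
by rewrite !expf_neq0 ?(gt_eqF pos216).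
Qed.

Let scale_le s j k : 0 < s -> (j <= k)%N -> scale s k <= scale s j.
Proof.
move=> s0 jk; rewrite ler_pM2l// lef_pV2 ?posrE ?(exprn_gt0 _ pos216)//.
by apply: ler_weXn2l => //; rewrite ler1n.
Qed.

(* The strict inequality forces the ball of radius t to have positive measure.
   As 216 = 6^3, the ball of radius 6t is then doubling, and its measure is at
   most beta0 times the measure of the ball of radius t. *)
Definition small_doubling (s : R) y (t : R) : Prop :=
  [/\ 0 < t, t <= s,
      mass mu (ball y (216 * t)) < beta0 * mass mu (ball y t) &
      shell_int y t s <= Clam ^+ 9 + growth_bound].

Lemma small_doubling_or_null (s : R) y m : 0 < s ->
  (exists2 t, small_doubling s y t & s / 216 ^+ m <= t) \/
  beta0 ^+ m * mass mu (ball y (s / 216 ^+ m)) <= mass mu (ball y s).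
Proof.
move=> s0; have C1 := le_trans ler01 (Clam_ge1 y).
pose good k := (k < m)%N &&
  (mass mu (ball y (scale s k)) < beta0 * mass mu (ball y (scale s k.+1))).
have [exk|nexk] := pselect (exists k, good k).
  left; have [k /andP[km gk] kmin] := ex_minnP exk.
  have k0 := scale_gt0 k.+1 s0.
  have E216 : 216 * scale s k.+1 = scale s k.
    by rewrite -(expr1 216) scaleM// subn1.
  exists (scale s k.+1); last exact: scale_le.
  split => //.
  - by have := @scale_le s 0 k.+1 s0 isT; rewrite scale0.
  - by rewrite E216.
  - apply: le_trans (shell_int_cat _ _ k0 (scale_gt0 k s0)) _; apply: lerD.
      apply: shell_int_ratio => //; rewrite -E216 ler_pM2r//.
      by rewrite -natrX ler_nat.
    rewrite [X in shell_int _ _ X](_ : s = 216 ^+ k * scale s k); last first.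
      by rewrite scaleM// subnn scale0.
    apply: shell_int_growth => //; [exact: scale_gt0|lra|] => j jk.
    rewrite !scaleM//; last exact: ltnW.
    have jE : (k - j = (k - j.+1).+1)%N by rewrite subnSK.
    rewrite jE leNgt; apply/negP => h.
    have /kmin : good (k - j.+1)%N.
      by rewrite /good h andbT; apply: leq_ltn_trans km; rewrite leq_subr.
    by rewrite -subn_gt0 in jk; rewrite leqNgt -jE leq_subr.
right.
have := @iter_growth (fun j => mass mu (ball y (scale s (m - j)%N))) 0 m.
rewrite /= add0n subn0 subnn scale0; apply => j jm.
rewrite leNgt; apply/negP => h; apply: nexk; exists (m - j.+1)%N.
by rewrite /good subnSK// h andbT leq_subr.
Qed.

Lemma doubling_cover x r (s e : R) : 0 < r -> 0 < s -> s <= r -> 0 < e ->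
  exists (rad : X -> R) (ys : seq X) (U : set X),
  [/\ [/\ measurable U, U `<=` ball x (3 * r) & (mu U < e%:E)%E],
      ball x r `<=` U `|` \bigcup_(y in [set` ys]) ball y (6 * rad y),
      forall y, y \in ys -> ball x r y /\ small_doubling s y (rad y) &
      pairwise (fun y z => `[< ball y (rad y) `&` ball z (rad z) = set0 >]) ys].
Proof.
move=> r0 s0 sr e0; have b0 := beta0_gt0.
have N1 : 1 <= N%:R :> R by rewrite ler1n (N_gt0 x).
have N0 : 0 <= N%:R :> R by rewrite ler0n.
set M := mass mu (ball x (2 * r)).
have M0 : 0 <= M := mass_ge0 _.
have [p1 hp1] := nat_pow2_ge (2 * r / s).
set L := N%:R ^+ p1.+1 * M.
have L0 : 0 <= L by rewrite mulr_ge0 ?exprn_ge0.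
have [m hm] : exists m, (Dn / beta0) ^+ m < e / (L + 1).
  apply: geometric_lt.
  - by rewrite divr_ge0 ?powR_ge0// ltW.
  - by rewrite ltr_pdivrMr// mul1r; exact: Dn_lt x.
  - by rewrite divr_gt0// ltr_wpDl.
have [p2 hp2 hp2'] := pow216_le_pow2 m N1.
have [cs csN xcs] := cover_pow2 x (p1 + p2)%N r0.
set eps := r / 2 ^+ (p1 + p2) in xcs.
have eps0 : 0 < eps by rewrite divr_gt0// exprn_gt0.
have epsm : 2 * eps <= scale s m.
  rewrite /eps /scale exprD mulrA ler_pdivrMr ?mulr_gt0 ?exprn_gt0//.
  rewrite mulrAC ler_pdivlMr ?exprn_gt0//.
  apply: (@le_trans _ _ (2 * r * 2 ^+ p2)).
    by rewrite ler_wpM2l// mulr_ge0// ltW.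
  by rewrite (mulrA s) ler_pM2r ?exprn_gt0// (mulrC s) -ler_pdivrMr.
have sm : scale s m <= s.
  by have := @scale_le s 0 m s0 isT; rewrite scale0.
pose good y := exists2 t, small_doubling s y t & scale s m <= t.
have /choice[rad radP] : forall y, exists t, good y ->
    small_doubling s y t /\ scale s m <= t.
  move=> y; have [[t ? ?]|ng] := pselect (good y); first by exists t.
  by exists 0 => /ng.
pose A c := ball c eps `&` ball x r `&` good.
pose B c := ball c eps `&` ball x r !=set0 /\ ~ (A c !=set0).
have /choice[g gP] : forall c, exists y, A c !=set0 -> A c y.
  move=> c; have [[y Ay]|nA] := pselect (A c !=set0); first by exists y.
  by exists x => /nA.
pose s1 := [seq c <- cs | `[< A c !=set0 >]].
pose s2 := [seq c <- cs | `[< B c >]].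
have [ys [ysub ypw ycov]] := vitali_list rad [seq g c | c <- s1].
have gxs y : y \in [seq g c | c <- s1] -> ball x r y /\ good y.
  move=> /mapP[c]; rewrite mem_filter => /andP[/asboolP Ac _] ->.
  by have [[]] := gP c Ac.
have Fx c : B c -> ball c eps `<=` ball x (3 * r).
  move=> [/ball_meet xc _]; apply: subset_ball; lra.
set U := \bigcup_(c in [set` s2]) ball c eps.
have mU : measurable U.
  by rewrite /U bigcup_seq; apply: bigsetU_measurable => i _;
    exact: measurable_ball.
have Ux : U `<=` ball x (3 * r).
  move=> z [c /=]; rewrite mem_filter => /andP[/asboolP Bc _].
  exact: Fx.
exists rad, ys, U; split => //.
- split => //.
  rewrite -massE; last exact: mu_sub_fin Ux.
  rewrite lte_fin; apply: (@le_lt_trans _ _ (\sum_(c <- s2) M / beta0 ^+ m)).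
    apply: (@le_trans _ _ (\sum_(c <- s2) mass mu (ball c eps `&` ball x (3 *
      r)))).
      apply: (@mass_cover_le _ _ _ _ x (3 * r)) => //.
      + by move=> c; exact: measurableI.
      + move=> z Uz; have [c cs2 cz] := Uz; rewrite -bigcup_seq.
        by exists c => //; split => //; exact: Ux.
    rewrite !big_seq; apply: ler_sum => c.
    rewrite mem_filter => /andP[/asboolP Bc _].
    have [[y [cy xy]] nA] := Bc.
    have ngy : ~ good y by move=> gy; apply: nA; exists y.
    have [[t ? ?]|] := @small_doubling_or_null s y m s0.
      by exfalso; apply: ngy; exists t.
    rewrite -/(scale s m) => hy.
    rewrite ler_pdivlMr ?exprn_gt0// mulrC.
    move/ballP: cy => cy; move/ballP: xy => xy.
    have h1 : mass mu (ball c eps `&` ball x (3 * r)) <=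
      mass mu (ball y (scale s m)).
      apply: mass_le => //; first exact: measurableI.
      by apply: subset_trans (@subIsetl _ _ _) _; apply: subset_ball; lra.
    apply: (@le_trans _ _ (mass mu (ball y s))).
      by apply: le_trans hy; rewrite ler_wpM2l// exprn_ge0// ltW.
    by apply: mass_ball_le; rewrite metric_sym; lra.
  rewrite big_const_seq iter_addr addr0 count_predT -mulr_natl.
  have h2 : (size s2)%:R <= N%:R ^+ p1 * (N%:R * Dn ^+ m) :> R.
    apply: (@le_trans _ _ (N%:R ^+ (p1 + p2))).
      by rewrite -natrX ler_nat; apply: leq_trans csN;
        rewrite size_filter count_size.
    by rewrite exprD ler_wpM2l ?exprn_ge0.
  have Mb : 0 <= M / beta0 ^+ m by rewrite divr_ge0// exprn_ge0// ltW.
  apply: le_lt_trans (ler_wpM2r Mb h2) _.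
  have -> : N%:R ^+ p1 * (N%:R * Dn ^+ m) * (M / beta0 ^+ m) =
    L * (Dn / beta0) ^+ m.
    by rewrite /L expr_div_n exprSr; ring.
  have L1 : 0 < L + 1 by rewrite ltr_wpDl.
  rewrite ltr_pdivlMr// in hm; apply: le_lt_trans hm.
  rewrite mulrC ler_wpM2l ?lerDl// exprn_ge0// divr_ge0 ?powR_ge0//; exact: ltW.
- move=> z xz; have [c /= ccs cz] := xcs _ xz.
  have [Ac|nA] := pselect (A c !=set0); last first.
    left; exists c => //=; rewrite mem_filter ccs andbT; apply/asboolP;
      split => //.
    by exists z.
  right; have [[cy xy] gy] := gP c Ac.
  have gcs : g c \in [seq g c | c <- s1].
    by apply: map_f; rewrite mem_filter ccs andbT; apply/asboolP.
  have [[rad0 _ _ _] sgc] := radP _ gy.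
  have [y [yys gcy dy]] := ycov _ gcs rad0.
  exists y => //; apply/ballP; rewrite metric_sym.
  move/ballP: cz => cz; move/ballP: cy => cy.
  have := metric_triangle z c y; have := metric_triangle c (g c) y.
  rewrite (metric_sym z c); lra.
- move=> y /ysub/gxs[xy gy]; split => //.
  by have [] := radP _ gy.
Qed.

(** * The implications between the three conditions *)

Lemma integrable_deviation f (c : R) x r : L1loc mu f ->
  mu.-integrable (ball x r) (EFin \o (fun z => f z - c)).
Proof.
move=> lf.
have r1 : 0 < Num.max 1 r by rewrite lt_max ltr01.
have sub : ball x r `<=` ball x (Num.max 1 r).
  by apply: subset_ball_center; rewrite le_max lexx orbT.
have fi : mu.-integrable (ball x r) (EFin \o f).
  exact: (integrableS (measurable_ball x (Num.max 1 r))
    (measurable_ball x r) sub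
    (lf (MBall x r1))).
rewrite (_ : _ \o _ = ((EFin \o f) \- (EFin \o cst c))%E)//.
by apply: integrableB => //; exact: integrable_cst_fin.
Qed.

Lemma integrable_norm_deviation f (c : R) x r : L1loc mu f ->
  mu.-integrable (ball x r) (EFin \o (fun z => `|f z - c|)).
Proof. by move=> lf; exact: (integrable_norm (integrable_deviation c x r lf)).
  Qed.

Lemma deviation_change f (c c' : R) x r : L1loc mu f ->
  \int[mu]_(z in ball x r) `|f z - c| <=
  \int[mu]_(z in ball x r) `|f z - c'| + `|c' - c| * mass mu (ball x r).
Proof.
move=> lf; rewrite -Rintegral_cst// -RintegralD//; last 2 first.
- exact: integrable_norm_deviation.
- exact: integrable_cst_fin.
apply: le_Rintegral => //; first exact: integrable_norm_deviation.
  have := integrableD (measurable_ball x r)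
    (integrable_norm_deviation c' x r lf)
    (integrable_cst_fin `|c' - c| (measurable_ball x r) (mu_ball_fin x r)).
  exact.
move=> z _; rewrite (_ : f z - c = (f z - c') + (c' - c)); last by ring.
exact: ler_normD.
Qed.

Lemma mean_deviation f (c : R) B : L1loc mu f -> (0 < mu B)%E ->
  `|mean mu f B - c| * mass mu B <= \int[mu]_(z in B) `|f z - c|.
Proof.
move=> lf Bpos; have mB : 0 < mass mu B.
  by apply: mass_gt0 => //; exact: mu_ball_fin.
rewrite -[X in _ * X]gtr0_norm// -normrM mulrBl /mean mulrAC mulVf ?gt_eqF//
  mul1r.
rewrite -(@Rintegral_cst _ _ _ mu B)//; last exact: measurable_ball.
rewrite -RintegralB; last 3 first.
- exact: measurable_ball.
- exact: lf.
- by apply: integrable_cst_fin; [exact: measurable_ball|exact: mu_ball_fin].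
apply: le_normr_Rintegral; first exact: measurable_ball.
exact: integrable_deviation.
Qed.

Lemma doubling_deviation_le rho : X -> 1 < rho -> exists2 A : R, 0 <= A &
  forall f C B S, L1loc mu f -> doubling_ball_const mu lam beta0 f C ->
    doubling_hull B S ->
    \int[mu]_(z in B) `|f z - mean mu f S| <=
      A * C * mass mu (ball (center B) (rho * radius B)).
Proof.
move=> x0 rho1; have b0 := beta0_gt0; have C1 := le_trans ler01 (Clam_ge1 x0).
pose delta := Num.min (1 / 6) (rho - 1).
have d0 : 0 < delta by rewrite lt_min subr_gt0 rho1 andbT; lra.
have d6 : delta <= 1 / 6 by rewrite ge_min lexx.
have dr : delta <= rho - 1 by rewrite ge_min lexx orbT.
have [p hp] := nat_pow2_ge delta^-1.
pose Jb := Clam ^+ 9 + growth_bound + Clam ^+ p.+1.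
have Jb0 : 0 <= Jb.
  by apply: addr_ge0; [apply: addr_ge0;
    [exact: exprn_ge0|exact: growth_bound_ge0 x0]|exact: exprn_ge0].
pose H := hull_bound Clam * (1 + Jb).
have H0 : 0 <= H by apply: mulr_ge0;
  [exact: hull_bound_ge0 x0 _ C1|exact: addr_ge0].
exists ((1 + H) * beta0); first by apply: mulr_ge0;
  [exact: addr_ge0|exact: ltW].
move=> f C B S lf fC hS; have [Cge0 fC1 _] := fC.
set x := center B; set r := radius B; set c := mean mu f S.
have r0 : 0 < r := radius_gt0 B.
pose s := delta * r; have s0 : 0 < s by rewrite mulr_gt0.
have s6 : 6 * s <= r by rewrite /s; nra.
have sr : s <= r by lra.
have srho : s <= (rho - 1) * r by rewrite ler_pM2r.
have rs : r <= 2 ^+ p * s.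
  by rewrite /s mulrA ler_peMl ?(ltW r0)// -ler_pdivrMr// div1r.
apply/ler_addgt0Pr => e e0.
have [dd dd0 small] := Rintegral_small (measurable_ball x (3 * r))
  (integrable_deviation c x (3 * r) lf) e0.
have [rad [ys [U [[mU Ux Ud] Bcov ysP ypw]]]] := doubling_cover x r0 s0 sr dd0.
pose F (o : option X) := if o is Some y then
  (if y \in ys then ball y (6 * rad y) else set0) else U.
have Fsub y : y \in ys -> ball y (6 * rad y) `<=` ball x (3 * r).
  move=> yys; have [/ballP xy [t0 ts _ _]] := ysP y yys.
  by apply: subset_ball; rewrite metric_sym; lra.
have main : \int[mu]_(z in B) `|f z - c| <=
    \sum_(o <- None :: [seq Some y | y <- ys]) \int[mu]_(z in F o) `|f z - c|.
  apply: (@Rintegral_cover _ _ _ mu _ _ predT F B (ball x (3 * r))) => //.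
  - exact: measurable_ball.
  - case=> //= y; case: ifP => // _; exact: measurable_ball.
  - by apply: subset_ball_center; rewrite -/r; lra.
  - by case=> [y _|_] //=; case: ifPn => [yys|_]; [exact: Fsub|exact: sub0set].
  - exact: integrable_norm_deviation.
  - move=> z /Bcov; rewrite -bigcup_seq => -[Uz|[y /= yys yz]].
      by exists None => //=; rewrite inE eqxx.
    by exists (Some y) => /=; rewrite ?yys// inE map_f ?orbT.
apply: le_trans main _; rewrite big_cons addrC lerD//; last first.
  by rewrite /F ltW//; exact: small.
rewrite big_map.
apply: (@le_trans _ _ (\sum_(y <- ys)
  (1 + H) * beta0 * C * mass mu (ball y (rad y)))).
  rewrite !big_seq; apply: ler_sum => y yys; rewrite /= yys.
  have [/ballP xy [t0 ts dbl JJ]] := ysP y yys.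
  have t60 : 0 < 6 * rad y by rewrite mulr_gt0.
  pose P := MBall y t60.
  have m1 : 0 < mass mu (ball y (rad y)).
    by rewrite -(pmulr_rgt0 _ b0); apply: le_lt_trans dbl; exact: mass_ge0.
  have m16 : mass mu (ball y (rad y)) <= mass mu P.
    by apply: mass_ball_le; rewrite mdistxx /=; lra.
  have m6 : mass mu P <= beta0 * mass mu (ball y (rad y)).
    apply: le_trans (ltW dbl); apply: mass_ball_le; rewrite mdistxx /=.
    by rewrite add0r ler_pM2r// ler_nat.
  have Ppos : (0 < mu P)%E.
    rewrite -massE; last exact: mu_ball_fin.
    by rewrite lte_fin; exact: lt_le_trans m16.
  have Pdbl : doubling_ball mu 6 beta0 P.
    apply/doubling_ballE;
      apply: (@le_trans _ _ (beta0 * mass mu (ball y (rad y)))).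
      apply: le_trans (ltW dbl); apply: mass_ball_le; rewrite mdistxx /=.
      by rewrite add0r mulrA ler_pM2r// -natrM ler_nat.
    by rewrite ler_pM2l.
  have JP : shell_int y (6 * rad y) r <= Jb.
    apply: (@le_trans _ _ (shell_int y (rad y) r)).
      by apply: shell_int_subset => //; lra.
    apply: le_trans (shell_int_cat _ _ t0 s0) _; apply: lerD => //.
    exact: shell_int_ratio.
  have Pmean : `|mean mu f P - c| <= C * H.
    have := @mean_hull_le f C Clam P B S fC C1 Ppos Pdbl hS.
    rewrite /= -/x -/r (metric_sym y x) => /(_ (ltW xy) _)/le_trans; apply.
      rewrite -[leRHS]expr1; apply: shell_int_ratio => //.
      by rewrite expr0 mul1r; lra.
    rewrite ler_wpM2l// ler_wpM2l ?lerD2l//; exact: hull_bound_ge0 x0 _ C1.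
  apply: le_trans (deviation_change c (mean mu f P) y (6 * rad y) lf) _.
  have h1 : \int[mu]_(z in P) `|f z - mean mu f P| <= C * mass mu P.
    have := fC1 P Ppos Pdbl; rewrite mulrC ler_pdivrMr//.
    exact: lt_le_trans m16.
  have h2 := ler_wpM2r (mass_ge0 P) Pmean.
  apply: le_trans (lerD h1 h2) _.
  rewrite [leLHS](_ : _ = C * (1 + H) * mass mu P); last by ring.
  rewrite [leRHS](_ : _ = C * (1 + H) * (beta0 * mass mu (ball y (rad y))));
    last by ring.
  by rewrite ler_wpM2l// mulr_ge0// addr_ge0.
rewrite -mulr_sumr; apply: ler_wpM2l.
  by apply: mulr_ge0 => //; apply: mulr_ge0; [exact: addr_ge0|exact: ltW].
apply: (@mass_disjoint_le (fun y => ball y (rad y))) => //.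
move=> y /ysP[/ballP xy [t0 ts _ _]].
apply: subset_ball; rewrite metric_sym; rewrite mulrBl mul1r in srho; lra.
Qed.

Lemma doubling_ball_const_RBMO rho : X -> 1 < rho -> exists2 A : R, 0 <= A &
  forall f C, L1loc mu f -> doubling_ball_const mu lam beta0 f C ->
    RBMO_const mu lam rho f (A * C).
Proof.
move=> x0 rho1; have C1 := le_trans ler01 (Clam_ge1 x0).
have [A1 A10 osc] := doubling_deviation_le x0 rho1.
pose a := Clam ^+ 2 + center_bound * (1 + growth_bound).
have a0 : 0 <= a.
  have G0 := growth_bound_ge0 x0; have c0 := center_bound_ge0 x0.
  apply: addr_ge0; first exact: exprn_ge0.
  by apply: mulr_ge0 => //; exact: addr_ge0.
have H0 := hull_bound_ge0 x0 a0.
exists (A1 + hull_bound a); first exact: addr_ge0.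
move=> f C lf fC; have [Cge0 _ _] := fC.
have AC0 : 0 <= (A1 + hull_bound a) * C by rewrite mulr_ge0// addr_ge0.
have [[B0 B0pos]|noB] := pselect (exists B : mball X, (0 < mu B)%E); last first.
  have m0 B : mass mu B = 0.
    rewrite /mass; suff -> : mu B = 0%E by [].
    apply/eqP; rewrite eq_le measure_ge0 andbT leNgt; apply/negP => h.
    by apply: noB; exists B.
  exists (fun=> 0); split => [B|B Q _].
    have rB : 0 < rho * radius B by rewrite mulr_gt0 ?radius_gt0//; lra.
    by have := m0 (MBall (center B) rB); rewrite /dilate => ->;
      rewrite invr0 mul0r.
  by rewrite subr0 normr0 mulr_ge0// (le_trans ler01)// K_ge1.
have /choice[T TP] := fun B => exists_doubling_hull B B0pos.
exists (fun B => mean mu f (T B)); split => [B|B Q BQ].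
  have := osc f C B (T B) lf fC (TP B); set M := mass mu _ => h.
  have M0 : 0 <= M := mass_ge0 _.
  rewrite -/M; move: M0; rewrite le_eqVlt => /predU1P[M0|M0].
    by rewrite -M0 invr0 mul0r.
  rewrite mulrC ler_pdivrMr//; apply: le_trans h _.
  by rewrite ler_pM2r// ler_wpM2r// lerDl.
have [TB BT Tpos Tdbl JT] := TP B.
have BQ' : mdist (center B) (center Q) <= radius Q.
  have /ballP : ball (center Q) (radius Q) (center B).
    by apply: BQ; apply/ballP; rewrite mdistxx radius_gt0.
  by rewrite metric_sym => /ltW.
have := mean_hull_le fC a0 Tpos Tdbl (TP Q).
rewrite TB => /(_ BQ' (hull_shell_sub BQ (TP B)))/le_trans; apply.
rewrite mulrA (mulrC C) KE; apply: ler_pM.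
- exact: mulr_ge0.
- by rewrite addr_ge0// shell_int_ge0// radius_gt0.
- by rewrite ler_wpM2r// lerDr.
- by rewrite lerD2l; apply: shell_int_subset => //; exact: radius_gt0.
Qed.

Lemma RBMO_const_ge0 rho f C : X -> RBMO_const mu lam rho f C -> 0 <= C.
Proof.
move=> x [fB [h _]]; apply: le_trans (h (MBall x (ltr01 : 0 < 1 :> R))).
by rewrite mulr_ge0 ?invr_ge0 ?mass_ge0// Rintegral_ge0.
Qed.

(* Changing the dilation factor: a ball is covered by small balls whose
   rho-dilates stay in the 6-dilate of that ball. *)
Lemma RBMO_deviation_le rho : X -> 1 < rho -> exists2 A : R, 0 <= A &
  forall f C (fB : mball X -> R) B, L1loc mu f ->
    (forall S, (mass mu (dilate rho S))^-1 * \int[mu]_(z in S) `|f z - fB S| <=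
      C) ->
    (forall S Q, S `<=` Q -> `|fB S - fB Q| <= C * K mu lam S Q) ->
    \int[mu]_(z in B) `|f z - fB B| <=
      A * C * mass mu (ball (center B) (6 * radius B)).
Proof.
move=> x0 rho1; have C1 := le_trans ler01 (Clam_ge1 x0).
have rho0 : 0 < rho by lra.
have [p hp] := nat_pow2_ge rho.
pose A2 := 1 + (1 + Clam ^+ (p + 3).+1 + (1 + Clam ^+ 4)).
have A20 : 0 <= A2 by rewrite /A2 !addr_ge0// exprn_ge0.
exists (N%:R ^+ p * A2); first by rewrite mulr_ge0// exprn_ge0.
move=> f C fB B lf osc dif.
set x := center B; set r := radius B.
have r0 : 0 < r := radius_gt0 B.
have p0 : 0 < 2 ^+ p :> R by rewrite exprn_gt0.
have p1 : 1 <= 2 ^+ p :> R by rewrite exprn_ege1//; lra.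
pose eps := r / 2 ^+ p; have eps0 : 0 < eps by rewrite divr_gt0.
have epsr : eps <= r by rewrite ler_pdivrMr// ler_peMr// ltW.
have rhoeps : rho * eps <= r by rewrite /eps mulrA ler_pdivrMr// mulrC ler_pM2l.
have C0 : 0 <= C.
  by apply: le_trans (osc B);
    rewrite mulr_ge0 ?invr_ge0 ?mass_ge0// Rintegral_ge0.
have r60 : 0 < 6 * r by rewrite mulr_gt0.
pose B6 := MBall x r60; set M := mass mu (ball x (6 * r)).
have M0 : 0 <= M := mass_ge0 _.
have [cs csN Bcs] := cover_pow2 x p r0; rewrite -/eps in Bcs.
pose meets c := `[< ball c eps `&` ball x r !=set0 >].
have meetsP c : meets c -> mdist c x < eps + r.
  by move=> /asboolP/ball_meet.
have dB : `|fB B - fB B6| <= C * (1 + Clam ^+ 4).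
  have BB6 : B `<=` B6 by apply: subset_ball_center; rewrite /= -/r; lra.
  apply: le_trans (dif B B6 BB6) _; rewrite ler_wpM2l// KE lerD2l.
  apply: shell_int_ratio => //=; rewrite -/r ler_pM2r//.
  by rewrite -natrX ler_nat.
have main : \int[mu]_(z in B) `|f z - fB B| <=
    \sum_(c <- cs | meets c) \int[mu]_(z in ball c eps) `|f z - fB B|.
  apply: (@Rintegral_cover _ _ _ mu _ _ meets _ B (ball x (6 * r))) => //.
  - exact: measurable_ball.
  - by apply: subset_ball_center; rewrite -/r; lra.
  - by move=> c /meetsP xc; apply: subset_ball; lra.
  - exact: integrable_norm_deviation.
  - move=> z Bz; have [c /= ccs cz] := Bcs z Bz.
    rewrite -bigcup_seq_cond; exists c => //=; rewrite ccs; apply/asboolP.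
    by exists z.
apply: le_trans main _.
apply: (@le_trans _ _ (\sum_(c <- cs | meets c) A2 * C * M)).
  apply: ler_sum => c /meetsP xc.
  pose S := MBall c eps0.
  have SB6 : S `<=` B6 by apply: subset_ball => /=; lra.
  have mS : mass mu S <= M by apply: mass_ball_le => /=; lra.
  have dS : `|fB S - fB B6| <= C * (1 + Clam ^+ (p + 3).+1).
    apply: le_trans (dif S B6 SB6) _; rewrite ler_wpM2l// KE lerD2l.
    apply: shell_int_ratio => //=; rewrite [leRHS](_ : _ = 2 ^+ 3 * r).
      by rewrite ler_pM2r// -natrX ler_nat.
    by rewrite exprD /eps; field; rewrite gt_eqF.
  have h1 : \int[mu]_(z in S) `|f z - fB S| <= C * M.
    have m0 : 0 <= mass mu (dilate rho S) := mass_ge0 _.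
    have mM : mass mu (dilate rho S) <= M by apply: mass_ball_le => /=; lra.
    move: m0 (osc S); rewrite le_eqVlt => /predU1P[m0 _|m0].
      have S0 : mu S = 0%E.
        have : mass mu S <= 0.
          by rewrite m0; apply: mass_ball_le;
            rewrite mdistxx /= add0r ler_peMl// ltW.
        rewrite -lee_fin massE; last exact: mu_ball_fin.
        by move=> S0; apply/eqP; rewrite eq_le S0 measure_ge0.
      rewrite /Rintegral null_set_integral//= ?mulr_ge0//;
        first exact: measurable_ball.
      exact: (measurable_int mu (integrable_norm_deviation (fB S) c eps lf)).
    rewrite mulrC ler_pdivrMr// => /le_trans; apply.
    by rewrite ler_wpM2l.
  have h2 : `|fB S - fB B| <= C * (1 + Clam ^+ (p + 3).+1 + (1 + Clam ^+ 4)).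
    rewrite (_ : fB S - fB B = (fB S - fB B6) - (fB B - fB B6)); last by ring.
    by apply: le_trans (ler_normB _ _) _; rewrite mulrDr; exact: lerD.
  apply: le_trans (deviation_change (fB B) (fB S) c eps lf) _.
  have -> : A2 * C * M =
    C * M + C * (1 + Clam ^+ (p + 3).+1 + (1 + Clam ^+ 4)) * M.
    by rewrite /A2; ring.
  apply: lerD => //; apply: ler_pM => //; exact: mass_ge0.
have T0 : 0 <= A2 * C * M by rewrite !mulr_ge0.
apply: (@le_trans _ _ (\sum_(c <- cs) A2 * C * M)).
  by rewrite big_mkcond; apply: ler_sum => c _; case: ifP.
rewrite big_const_seq iter_addr addr0 count_predT -[leLHS]mulr_natl.
rewrite [leRHS](_ : _ = N%:R ^+ p * (A2 * C * M)); last by rewrite !mulrA.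
by rewrite ler_wpM2r// -natrX ler_nat.
Qed.

Lemma RBMO_ball_const rho : X -> 1 < rho -> exists2 A : R, 0 <= A &
  forall f C, L1loc mu f -> RBMO_const mu lam rho f C ->
    ball_const mu lam f (A * C).
Proof.
move=> x0 rho1; have [A A0 dev] := RBMO_deviation_le x0 rho1.
exists (2 * A + 1); first by rewrite addr_ge0// mulr_ge0.
move=> f C lf fC; have C0 := RBMO_const_ge0 x0 fC; have [fB [osc dif]] := fC.
have mpos B : (0 < mu B)%E -> 0 < mass mu B.
  by apply: mass_gt0; exact: mu_ball_fin.
have ratio B : (0 < mu B)%E -> 1 <= mass mu (dilate 6 B) / mass mu B.
  move=> /mpos Bpos; rewrite ler_pdivlMr// mul1r; apply: mass_ball_le.
  by rewrite mdistxx add0r ler_peMl ?(ltW (radius_gt0 B))//; lra.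
have meanB B : (0 < mu B)%E ->
    `|mean mu f B - fB B| <= A * C * (mass mu (dilate 6 B) / mass mu B).
  move=> Bpos; rewrite mulrA ler_pdivlMr ?mpos//.
  exact: le_trans (mean_deviation (fB B) lf Bpos) (dev f C fB B lf osc dif).
split; first by rewrite mulr_ge0// addr_ge0// mulr_ge0.
- move=> B Bpos; have mB := mpos _ Bpos.
  have m6 : 0 < mass mu (dilate 6 B).
    by have := ratio _ Bpos; rewrite ler_pdivlMr// mul1r; exact: lt_le_trans.
  rewrite mulrC ler_pdivrMr//.
  apply: le_trans (deviation_change (mean mu f B) (fB B) _ _ lf) _.
  have h1 := dev f C fB B lf osc dif.
  have h2 := meanB B Bpos; rewrite mulrA ler_pdivlMr// distrC in h2.
  apply: le_trans (lerD h1 h2) _.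
  rewrite -[ball _ _]/(dilate 6 B).
  have : 0 <= C * mass mu (dilate 6 B) by rewrite mulr_ge0// ltW.
  rewrite -(mulrA A) -(mulrA _ C); move: (C * _) => u u0; lra.
- move=> Q S Qpos Spos QS.
  have hQ := meanB Q Qpos; have hS := meanB S Spos.
  have rQ := ratio Q Qpos; have rS := ratio S Spos; have K1 := K_ge1 Q S.
  rewrite (_ : mean mu f Q - _ = (mean mu f Q - fB Q) + (fB Q - fB S) -
    (mean mu f S - fB S)); last by ring.
  apply: le_trans (ler_normB _ _) _.
  apply: le_trans (lerD (ler_normD _ _) (lexx _)) _.
  apply: le_trans (lerD (lerD hQ (dif Q S QS)) hS) _.
  move: (mass mu (dilate 6 Q) / _)
    (mass mu (dilate 6 S) / _) rQ rS => u v u1 v1.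
  move: (K mu lam Q S) K1 => k k1.
  have AC : 0 <= A * C by rewrite mulr_ge0.
  have e1 : 0 <= A * C * (k - 1) * (u + v).
    by rewrite mulr_ge0 ?mulr_ge0 ?subr_ge0//; lra.
  have e2 : 0 <= C * k * (u + v - 1) by rewrite !mulr_ge0//; lra.
  have e3 : 0 <= A * C * k * (u + v) by rewrite !mulr_ge0//; lra.
  lra.
Qed.

Lemma ball_const_doubling f C : ball_const mu lam f C ->
  doubling_ball_const mu lam beta0 f (2 * beta0 * C).
Proof.
move=> [C0 osc dif]; have b0 := beta0_gt0.
have ratio B : (0 < mu B)%E -> doubling_ball mu 6 beta0 B ->
    mass mu (dilate 6 B) / mass mu B <= beta0.
  move=> Bpos /doubling_ballE Bdbl; rewrite ler_pdivrMr//.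
  by apply: mass_gt0 => //; exact: mu_ball_fin.
split; first by rewrite !mulr_ge0// ltW.
- move=> B Bpos Bdbl; have mB : 0 < mass mu B.
    by apply: mass_gt0 => //; exact: mu_ball_fin.
  have m6 : 0 < mass mu (dilate 6 B).
    apply: lt_le_trans mB _; apply: mass_ball_le.
    by rewrite mdistxx add0r ler_peMl ?(ltW (radius_gt0 B))//; lra.
  have := osc B Bpos; rewrite !(mulrC _^-1) !ler_pdivrMr// => /le_trans; apply.
  have /doubling_ballE h := Bdbl; apply: le_trans (ler_wpM2l C0 h) _.
  have : 0 <= C * beta0 * mass mu B by rewrite !mulr_ge0// ltW.
  lra.
- move=> Q S Qpos Spos Qdbl Sdbl QS; apply: le_trans (dif Q S Qpos Spos QS) _.
  have h := lerD (ratio Q Qpos Qdbl) (ratio S Spos Sdbl).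
  have k0 : 0 <= C * K mu lam Q S by rewrite mulr_ge0// (le_trans ler01)//
    K_ge1.
  apply: le_trans (ler_wpM2l k0 h) _; lra.
Qed.

End upper_doubling_measure.

Theorem proposition3p4 (R : realType) (d : measure_display)
    (X : measurableMetricType d R) (mu : {measure set X -> \bar R})
    (lam : X -> R -> R) (N : nat) (Clam beta0 rho : R)
    (borelX : borel_measurable X)
    (doublingX : geometrically_doubling X N)
    (doubling_mu : upper_doubling mu lam Clam)
    (hbeta0 : doubling_threshold N Clam < beta0)
    (hrho : 1 < rho) :
  (forall f : X -> R, L1loc mu f ->
     (RBMO mu lam rho f <-> exists Cb : R, ball_const mu lam f Cb) /\
     (RBMO mu lam rho f <->
        exists Cc : R, doubling_ball_const mu lam beta0 f Cc)) /\
  comparable_on [set f | L1loc mu f /\ RBMO mu lam rho f]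
    (fun f => inf [set Cb | ball_const mu lam f Cb]) (RBMO_norm mu lam rho) /\
  comparable_on [set f | L1loc mu f /\ RBMO mu lam rho f]
    (fun f => inf [set Cc | doubling_ball_const mu lam beta0 f Cc])
    (RBMO_norm mu lam rho).
Proof.
have [[x0 _]|noX] := pselect (exists x : X, True); last first.
  have noB (B : mball X) : False by apply: noX; exists (center B).
  have a f C : RBMO_const mu lam rho f C.
    by exists (fun=> 0); split => B; have [] := noB B.
  have b f C : ball_const mu lam f C <-> 0 <= C.
    by split => [[]//|C0]; split => // B; have [] := noB B.
  have c f C : doubling_ball_const mu lam beta0 f C <-> 0 <= C.
    by split => [[]//|C0]; split => // B; have [] := noB B.
  have normE f : RBMO_norm mu lam rho f = 0.
    rewrite /RBMO_norm -[RHS]inf_setT; congr inf.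
    by apply/seteqP; split => // C _; exact: a.
  have bE f : inf [set C | ball_const mu lam f C] = 0.
    by rewrite -[RHS]inf_nneg; congr inf; apply/seteqP; split => C /= /b.
  have cE f : inf [set C | doubling_ball_const mu lam beta0 f C] = 0.
    by rewrite -[RHS]inf_nneg; congr inf; apply/seteqP; split => C /= /c.
  split=> [f _|].
    split; split => _.
    - by exists 0; apply/b.
    - by exists 0; exact: a.
    - by exists 0; apply/c.
    - by exists 0; exact: a.
  by split; exists 1 => // f _; rewrite normE ?bE ?cE !mulr0 lexx.
have [_ _ _ _ [Ccmp cmp]] := doubling_mu.
have [A A0 ab] := RBMO_ball_const borelX doubling_mu doublingX x0 hrho.
have [B B0 ca] :=
  doubling_ball_const_RBMO borelX doubling_mu cmp hbeta0 doublingX x0 hrho.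
have bc := ball_const_doubling borelX doubling_mu hbeta0.
have b0 : 0 <= beta0 by rewrite ltW// (beta0_gt0 hbeta0).
have a_ge0 f C : RBMO_const mu lam rho f C -> 0 <= C.
  exact: RBMO_const_ge0 x0.
split=> [f lf|].
  split; split => -[C fC].
  - by exists (A * C); exact: ab.
  - by exists (B * (2 * beta0 * C)); apply: ca => //; exact: bc.
  - by exists (2 * beta0 * (A * C)); apply: bc; exact: ab.
  - by exists (B * C); exact: ca.
split.
- apply: (@comparable_inf _ _ _ _ (RBMO_const mu lam rho) A (B * (2 * beta0)))
    => //.
  + by rewrite !mulr_ge0.
  + by move=> f C [].
  + by move=> f C [lf _]; exact: ab.
  + by move=> f C [lf _] /bc fC; rewrite -mulrA; exact: ca.
  + by move=> f [_].
- apply: (@comparable_inf _ _ _ _ (RBMO_const mu lam rho)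
    (2 * beta0 * A) B) => //.
  + by rewrite !mulr_ge0.
  + by move=> f C [].
  + by move=> f C [lf _] fC; rewrite -mulrA; apply: bc; exact: ab.
  + by move=> f C [lf _]; exact: ca.
  + by move=> f [_].
Qed.
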